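(* Let $\kappa$ be a regular cardinal such that $\kappa^{<\kappa}=\kappa$. Then any consistent $\kappa$-geometric theory of cardinality at most $\kappa$ has a Beth model.
   Context: A signature $\Sigma$ has sorts and function and relation symbols of arities of length $<\kappa$. $\kappa$-geometric formulas are built from atomic formulas using conjunctions of fewer than $\kappa$ formulas, existential quantification over fewer than $\kappa$ variables, and arbitrary disjunctions whose total set of free variables has size $<\kappa$; a $\kappa$-geometric theory is a set of sequents $\phi\vdash_{\mathbf{x}}\psi$ between such formulas (its axioms), and its cardinality is the number of axioms. Consistent means $\top\vdash\bot$ is not derivable in $\kappa$-geometric logic, i.e. the system of standard geometric sequent-calculus rules (for $\bigwedge$ of $<\kappa$ formulas, arbitrary $\bigvee$, $\exists$, distributivity, Frobenius, equality, substitution, cut) together with rule $T$: for a cardinal $\gamma$ and the tree $\gamma^{<\kappa}$ of functions $f:\beta\to\gamma$ ($\beta<\kappa$), if formulas $\phi_f$ satisfy $\phi_f\vdash\bigvee_{g\in\gamma^{\beta+1},g|_\beta=f}\exists\mathbf{x}_g\phi_g$ for each node $f\in\gamma^\beta$ and $\phi_f\dashv\vdash\bigwedge_{\alpha<\beta}\phi_{f|_\alpha}$ at limit levels (with $FV(\phi_g)=FV(\phi_{g|_\beta})\cup\mathbf{x}_g$, $\mathbf{x}_g$ fresh, and unions of free variables at limits), then $\phi_\emptyset\vdash\bigvee_{f\in B}\exists_{\beta<\delta_f}\mathbf{x}_{f|_{\beta+1}}\bigwedge_{\beta<\delta_f}\phi_{f|_{\beta+1}}$ for $B$ the minimal elements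 of any bar (upward closed set of nodes meeting every branch), $\delta_f$ the level of $f$. A Beth model over $\Sigma$ is a quadruple $(K,\leq,D,\Vdash)$ where $(K,\leq)$ is a tree of height $\kappa$ all of whose branches have size $\kappa$, $D$ is a set-valued functor on $K$ with transition maps $D_{kl}$ ($k\le l$), each $D(k)$ interprets the function and relation symbols with $R_k(\mathbf{c})\Rightarrow R_l(D_{kl}(\mathbf{c}))$, and forcing is defined by ($B_k$ = branches through $k$): $k\Vdash R(\mathbf{s}(\mathbf{d}))$ iff every $b\in B_k$ has $l\in b$ with $R_l(\mathbf{s}(D_{kl}(\mathbf{d})))$; $k\Vdash\bigwedge_i\phi_i(\mathbf{d})$ iff $k\Vdash\phi_i(\mathbf{d})$ for all $i$; $k\Vdash\bigvee_i\phi_i(\mathbf{d})$ iff every $b\in B_k$ has $l\in b$ and some $i$ with $l\Vdash\phi_i(D_{kl}(\mathbf{d}))$; $k\Vdash\exists\mathbf{x}\phi(\mathbf{x},\mathbf{d})$ iff every $b\in B_k$ has $l\in b$ and $\mathbf{e}$ from $D(l)$ with $l\Vdash\phi(\mathbf{e},D_{kl}(\mathbf{d}))$. A Beth model of a theory $\mathbb{T}$ is a Beth model forcing all axioms of $\mathbb{T}$ and not forcing $\bot$.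
   Formalization: The signature is assumed to have at most κ function symbols; counting only axioms the claim fails, e.g. for κ=ω with ω₁ constants forced distinct by one large disjunction and a countable family of predicates F_n covering the sort, each holding of at most one element. *)

(* Defs.v *)
From mathcomp Require Import all_boot all_order.
From mathcomp Require Import wochoice boolp classical_sets functions cardinality.

Set Implicit Arguments.
Unset Strict Implicit.
Unset Printing Implicit Defensive.
Import Order.TTheory.

Local Open Scope classical_set_scope.
Local Open Scope card_scope.
Local Open Scope order_scope.

(** * Regular cardinals and sequences of length < kappa *)

(* |A| < |U|, by comparability of cardinals *)
Definition card_lt (A U : Type) : bool := ~~ ([set: U] #<= [set: A]).

(* An infinite regular cardinal, given as an initial ordinal: a well-ordered
   type whose proper initial segments have smaller cardinality.  Its elements
   are the ordinals below kappa.  Regularity: a sum of fewer than kappa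
   cardinals, each smaller than kappa, is smaller than kappa. *)
Structure regularCardinal := RegularCardinal {
  rc_disp : Order.disp_t;
  rc_sort :> orderType rc_disp;
  rc_wo : well_order (<=%O : rel rc_sort);
  rc_initial : forall beta : rc_sort,
    card_lt {alpha : rc_sort | alpha < beta} rc_sort;
  rc_infinite : infinite_set [set: rc_sort];
  rc_regular : forall (I : Type) (A : I -> Type),
    card_lt I rc_sort -> (forall i, card_lt (A i) rc_sort) ->
    card_lt {i : I & A i} rc_sort
}.

Section Sequences.
Variable kappa : regularCardinal.

Definition small (A : Type) : bool := card_lt A kappa.

Definition seg (beta : kappa) : Type := {alpha : kappa | alpha < beta}.

Lemma seg_small beta : small (seg beta). Proof. exact: rc_initial. Qed.

Lemma card_le_injective (A B : Type) (f : A -> B) :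
  injective f -> [set: A] #<= [set: B].
Proof.
move=> finj; have [g] : $|{injfun [set: A] >-> [set: B]}|.
  by apply/injfunPex; exists f => // ? ? _ _; exact: finj.
exact: inj_card_le g.
Qed.

Lemma small_inj (A B : Type) (f : A -> B) :
  injective f -> small B -> small A.
Proof. by move=> /card_le_injective fi; apply: contra => /card_le_trans; apply. Qed.

Lemma small_finType (A : finType) : small A.
Proof.
apply/negP => /card_le_finite fin.
exact: (rc_infinite (fin (@finite_finset A _))).
Qed.

Lemma small_sum (A B : Type) : small A -> small B -> small (A + B).
Proof.
move=> sA sB.
have sAB : small {b : bool & if b then A else B}.
  by apply: rc_regular; [exact: small_finType | case].
pose T b := if b then A else B.
pose f (x : A + B) : {b : bool & T b} :=
  match x with inl a => existT T true a | inr b => existT T false b end.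
pose g (p : {b : bool & T b}) : A + B :=
  match p with existT true a => inl a | existT false b => inr b end.
by apply: (@small_inj _ _ f) sAB; apply: (can_inj (g := g)); case.
Qed.

Lemma exists_least (P : set kappa) :
  P !=set0 -> exists x, P x /\ forall y, P y -> x <= y.
Proof.
move=> [p Pp]; have [|x [[Px xmin] _]] := @rc_wo kappa [pred x | `[< P x >]].
  by exists p; apply/asboolP.
exists x; split; first exact/asboolP.
by move=> y Py; apply: xmin; apply/asboolP.
Qed.

Definition least (P : set kappa) (P0 : P !=set0) : kappa :=
  sval (cid (exists_least P0)).

Lemma leastP P (P0 : P !=set0) :
  P (least P0) /\ forall y, P y -> least P0 <= y.
Proof. exact: svalP (cid (exists_least P0)). Qed.

Lemma kappa_neq0 : [set: kappa] !=set0.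
Proof.
apply/set0P/eqP => e; apply: (@rc_infinite kappa); rewrite e; exact: finite_set0.
Qed.

Lemma above_neq0 (beta : kappa) : [set gamma : kappa | beta < gamma] !=set0.
Proof.
apply: contrapT => /set0P/negP/negPn/eqP e.
have le_beta x : x <= beta.
  by rewrite leNgt; apply/negP => ltx; have : @set0 kappa x by rewrite -e.
have : small (seg beta + unit)%type.
  by apply: small_sum; [exact: seg_small | exact: small_finType].
move/negP; apply.
pose f (x : kappa) : seg beta + unit :=
  match insub x : option (seg beta) with Some y => inl y | None => inr tt end.
apply: (@card_le_injective _ _ f) => x y; rewrite /f.
have eqb z : ~~ (z < beta) -> z = beta.
  by rewrite -leNgt => bz; apply/le_anti; rewrite le_beta.
case: insubP => [u _ <-|/eqb->]; case: insubP => [v _ <-|/eqb->] //.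
by case=> ->.
Qed.

Definition kzero : kappa := least kappa_neq0.
Definition ksucc (beta : kappa) : kappa := least (above_neq0 beta).
Definition is_limit (beta : kappa) : Prop :=
  beta <> kzero /\ forall alpha, beta <> ksucc alpha.

(* The sequences of length < kappa in A; for A a cardinal gamma this is the
   tree gamma^{<kappa}. *)
Definition kseq (A : Type) : Type := {beta : kappa & seg beta -> A}.

Definition len A (f : kseq A) : kappa := projT1 f.
Definition kat A (f : kseq A) (i : seg (len f)) : A := projT2 f i.

Lemma restr_subproof A (f : kseq A) alpha (i : seg (Order.min alpha (len f))) :
  val i < len f.
Proof. by have := valP i; rewrite lt_min => /andP[]. Qed.

(* f restricted to alpha (f itself when len f <= alpha) *)
Definition restr A (f : kseq A) (alpha : kappa) : kseq A :=
  existT (fun beta => seg beta -> A) (Order.min alpha (len f))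
    (fun i => @kat A f (exist _ (val i) (restr_subproof i))).

Lemma knil_subproof (i : seg kzero) : False.
Proof.
have := valP i; rewrite ltNge => /negP; apply.
by have [_] := leastP kappa_neq0; apply.
Qed.

Definition knil A : kseq A :=
  existT (fun beta => seg beta -> A) kzero
    (fun i => False_rect A (knil_subproof i)).

Definition kprefix A (f g : kseq A) : Prop := restr g (len f) = f.

Definition child A (f g : kseq A) : Prop :=
  len g = ksucc (len f) /\ restr g (len f) = f.

Definition initseg A (b : kappa -> A) (beta : kappa) : kseq A :=
  existT (fun beta => seg beta -> A) beta (fun i => b (val i)).

(* The branches of the tree A^{<kappa} are given by the functions kappa -> A. *)
Definition is_bar A (S : set (kseq A)) : Prop :=
  (forall f g, kprefix f g -> S f -> S g) /\
  (forall b : kappa -> A, exists beta, S (initseg b beta)).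

Definition minimal_in A (S : set (kseq A)) : set (kseq A) :=
  [set f | S f /\ forall g, kprefix g f -> S g -> g = f].

Lemma kseq_eq A (f g : kseq A) : len f = len g ->
  (forall i j, val i = val j -> @kat A f i = @kat A g j) -> f = g.
Proof.
case: f g => [a f] [b g]; rewrite /len /kat /= => e; case: b / e g => g efg.
by congr existT; apply/funext => i; apply: efg.
Qed.

Lemma restr_restr A (f : kseq A) alpha beta :
  alpha <= beta -> restr (restr f beta) alpha = restr f alpha.
Proof.
move=> ab; apply: kseq_eq => [|i j eij]; rewrite /len /kat /=.
  by rewrite minA (min_l ab).
by rewrite /kat; congr (projT2 f _); apply: val_inj.
Qed.

Lemma restr_ge A (f : kseq A) alpha : len f <= alpha -> restr f alpha = f.
Proof.
move=> fa; apply: kseq_eq => [|i j eij]; first by rewrite /len /= min_r.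
by rewrite /kat /=; rewrite /kat; congr (projT2 f _); apply: val_inj.
Qed.

Lemma len_restr A (f : kseq A) alpha :
  alpha <= len f -> len (restr f alpha) = alpha.
Proof. by move=> af; rewrite /len /= min_l. Qed.

Lemma len0 A (f : kseq A) : len f = kzero -> f = knil A.
Proof.
move=> f0; apply: kseq_eq => // i j _; case: (knil_subproof j).
Qed.

Lemma lt_ksucc beta : beta < ksucc beta.
Proof. by have [] := leastP (above_neq0 beta). Qed.

Lemma kappa_ind (P : kappa -> Prop) :
  (forall beta, (forall alpha, alpha < beta -> P alpha) -> P beta) ->
  forall beta, P beta.
Proof.
move=> IH beta; apply: contrapT => nP.
have [|x [nPx xmin]] := @exists_least [set x | ~ P x]; first by exists beta.
apply: nPx; apply: IH => a ax; apply: contrapT => /xmin.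
by rewrite leNgt ax.
Qed.

End Sequences.

Arguments knil {kappa A}.

(** * Syntax of kappa-geometric logic *)

Record signature (kappa : regularCardinal) := Signature {
  sorts : Type;
  fun_sym : Type;
  rel_sym : Type;
  fdom : fun_sym -> kseq kappa sorts;
  fcod : fun_sym -> sorts;
  rdom : rel_sym -> kseq kappa sorts
}.

Section Syntax.
Variables (kappa : regularCardinal) (Sigma : signature kappa).
Notation small := (small kappa).
Notation sorts := (sorts Sigma).

(* Contexts: sorted families of fewer than kappa variables *)
Record ctx := Ctx {
  vars :> sorts -> Type;
  vars_small : small {s & vars s}
}.

Lemma ctx0_subproof : small {s : sorts & void}.
Proof.
by apply: (@small_inj _ _ void (fun x => projT2 x)) (small_finType _ _) => -[? []].
Qed.

Definition ctx0 : ctx := Ctx ctx0_subproof.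

Lemma ctx_add_subproof (X Y : ctx) : small {s & (X s + Y s)%type}.
Proof.
pose f (p : {s & (X s + Y s)%type}) : {s & X s} + {s & Y s} :=
  match p with
  | existT s (inl x) => inl (existT (vars X) s x)
  | existT s (inr y) => inr (existT (vars Y) s y)
  end.
pose g (p : {s & X s} + {s & Y s}) : {s & (X s + Y s)%type} :=
  match p with
  | inl (existT s x) => existT (fun s => X s + Y s)%type s (inl x)
  | inr (existT s y) => existT (fun s => X s + Y s)%type s (inr y)
  end.
apply: (@small_inj _ _ _ f) (small_sum (vars_small X) (vars_small Y)).
by apply: (can_inj (g := g)) => -[s []].
Qed.

Definition ctx_add (X Y : ctx) : ctx := Ctx (ctx_add_subproof X Y).

Inductive term (X : sorts -> Type) : sorts -> Type :=
| Var s (x : X s) : term X s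
| App (f : fun_sym Sigma)
    (t : forall i : seg (len (fdom f)), term X (kat i)) : term X (fcod f).

(* Formulas in context.  Since a context has fewer than kappa variables, so
   does the set of free variables of a disjunction of arbitrary size. *)
Inductive formula : ctx -> Type :=
| Rel (X : ctx) (R : rel_sym Sigma)
    (t : forall i : seg (len (rdom R)), term X (kat i)) : formula X
| Eq (X : ctx) s (t u : term X s) : formula X
| And (X : ctx) (I : Type) (I_small : small I) (phi : I -> formula X) :
    formula X
| Or (X : ctx) (I : Type) (phi : I -> formula X) : formula X
| Ex (X Y : ctx) (phi : formula (ctx_add X Y)) : formula X.

Definition Top X : formula X :=
  And (small_finType kappa void) (fun i : void => match i with end).
Definition Bot X : formula X :=
  Or (fun i : void => match i with end : formula X).
Definition Conj X (phi psi : formula X) : formula X :=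
  And (small_finType kappa bool) (fun b : bool => if b then phi else psi).

Definition subst (X Y : sorts -> Type) : Type := forall s, X s -> term Y s.

Fixpoint tsubst (X Y : sorts -> Type) (sigma : subst X Y) s (t : term X s) :
    term Y s :=
  match t with
  | Var s x => sigma s x
  | App f ts => App (fun i => tsubst sigma (ts i))
  end.

Definition lift_subst (X Y Z : ctx) (sigma : subst X Y) :
    subst (ctx_add X Z) (ctx_add Y Z) :=
  fun s v => match v with
  | inl x => tsubst (fun s y => Var (X := ctx_add Y Z) (inl y)) (sigma s x)
  | inr z => Var (X := ctx_add Y Z) (inr z)
  end.

Fixpoint fsubst (X : ctx) (phi : formula X) :
    forall Y : ctx, subst X Y -> formula Y :=
  match phi in formula X return forall Y : ctx, subst X Y -> formula Y with
  | Rel X R t => fun Y sigma => Rel (fun i => tsubst sigma (t i))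
  | Eq X s t u => fun Y sigma => Eq (tsubst sigma t) (tsubst sigma u)
  | And X J sJ phi => fun Y sigma => And sJ (fun i => fsubst (phi i) sigma)
  | Or X J phi => fun Y sigma => Or (fun i => fsubst (phi i) sigma)
  | Ex X Z phi => fun Y sigma => Ex (fsubst phi (@lift_subst _ _ Z sigma))
  end.

Definition rename (X Y : ctx) (r : forall s, X s -> Y s) (phi : formula X) :
    formula Y :=
  fsubst phi (fun s x => Var (r s x)).

Definition weaken (X Y : ctx) (phi : formula X) : formula (ctx_add X Y) :=
  @rename X (ctx_add X Y) (fun s x => inl x) phi.

Record sequent := Sequent {
  sctx : ctx;
  antecedent : formula sctx;
  succedent : formula sctx
}.

(** * Families of variables for rule T *)

(* Sets of fewer than kappa variables taken among given names V *)
Record vset (V : sorts -> Type) := VSet {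
  vmem :> forall s, set (V s);
  vmem_small : small {s & {v : V s | vmem v}}
}.
Arguments vmem {V} A s _ : rename.

Definition vset_ctx V (A : vset V) : ctx := Ctx (vmem_small A).

Lemma vbigcup_subproof V (I : Type) (A : I -> vset V) :
  small I -> small {s & {v : V s | exists i, A i s v}}.
Proof.
move=> sI.
have sA : small {i & {s & {v : V s | A i s v}}}.
  by apply: rc_regular => // i; exact: vmem_small.
pose f (p : {s & {v : V s | exists i, A i s v}}) :
    {i & {s & {v : V s | A i s v}}} :=
  let: existT s (exist v h) := p in
  let: exist i Aiv := cid h in
  existT (fun i => {s & {v : V s | A i s v}}) i
    (existT (fun s => {v : V s | A i s v}) s (exist _ v Aiv)).
pose g (p : {i & {s & {v : V s | A i s v}}}) :
    {s & {v : V s | exists i, A i s v}} :=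
  let: existT i (existT s (exist v Aiv)) := p in
  existT (fun s => {v : V s | exists i, A i s v}) s
    (exist _ v (ex_intro _ i Aiv)).
apply: (@small_inj _ _ _ f) sA.
apply: (can_inj (g := g)) => -[s [v h]] /=; case: cid => i Aiv /=.
by congr existT; congr exist; apply: Prop_irrelevance.
Qed.

Definition vbigcup V (I : Type) (I_small : small I) (A : I -> vset V) :
    vset V :=
  VSet (vbigcup_subproof A I_small).

(* The free variables along the tree gamma^{<kappa}: vt_ctx f is the context
   of the formula at the node f, and vt_new g the block of fresh variables
   introduced at a node g of successor level. *)
Record var_tree (gamma : Type) := VarTree {
  vt_names : sorts -> Type;
  vt_ctx : kseq kappa gamma -> vset vt_names;
  vt_new : kseq kappa gamma -> vset vt_names;
  vt_child : forall f g, child f g ->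
    forall s, vt_ctx g s = vt_ctx f s `|` vt_new g s;
  vt_fresh : forall f g, child f g ->
    forall s, vt_ctx f s `&` vt_new g s = set0;
  vt_limit : forall f, is_limit (len f) ->
    forall s, vt_ctx f s =
      \bigcup_(alpha in [set alpha | alpha < len f]) vt_ctx (restr f alpha) s
}.

Section VarTree.
Variables (gamma : Type) (V : var_tree gamma).
Implicit Types f g : kseq kappa gamma.

(* The union of the blocks x_{f|(beta+1)}, for beta < len f *)
Definition vt_path f : vset (vt_names V) :=
  vbigcup (seg_small (len f))
    (fun beta => vt_new V (restr f (ksucc (val beta)))).

Lemma vt_child_sub f g : child f g ->
  forall s, vt_ctx V g s `<=` vt_ctx V f s `|` vt_new V g s.
Proof. by move=> fg s; rewrite (vt_child V fg). Qed.

Lemma vt_limit_sub f : is_limit (len f) -> forall alpha, alpha < len f ->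
  forall s, vt_ctx V (restr f alpha) s `<=` vt_ctx V f s.
Proof. by move=> fl alpha lta s v hv; rewrite (vt_limit V fl); exists alpha. Qed.

Lemma vt_path_sub f alpha s :
  vt_ctx V (restr f alpha) s `<=` vt_ctx V knil s `|` vt_path f s.
Proof.
elim/kappa_ind: alpha s => alpha IH s v.
have [fa|af] := ltP (len f) alpha.
  by rewrite restr_ge ?(ltW fa)// -{1}(restr_ge (lexx (len f))); exact: IH.
have lr := len_restr af.
have [a0|na0] := pselect (alpha = kzero kappa).
  by rewrite (@len0 _ _ (restr f alpha)) ?lr//; left.
have [[beta ab]|nS] := pselect (exists beta, alpha = ksucc beta).
  have ba : beta < alpha by rewrite ab; exact: lt_ksucc.
  have /vt_child_sub : child (restr f beta) (restr f alpha).
    rewrite /child lr len_restr ?(ltW (lt_le_trans ba af))//; split=> //.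
    by rewrite restr_restr// ltW.
  move=> /[apply] -[/IH|hv]; first exact.
  by right; exists (exist _ beta (lt_le_trans ba af)); rewrite /= -ab.
have lim : is_limit (len (restr f alpha)).
  by rewrite lr; split=> // beta ab; apply: nS; exists beta.
rewrite (vt_limit V lim) => -[beta]; rewrite /mkset lr => ba.
by rewrite restr_restr ?(ltW ba)//; exact: IH.
Qed.

End VarTree.

(* Used to read a formula with free variables C, included in A `|` B, as a
   formula in the context A extended by B, before quantifying over B. *)
Definition split_var V (A B C : vset V)
    (CAB : forall s, C s `<=` A s `|` B s) s (v : vset_ctx C s) :
    ctx_add (vset_ctx A) (vset_ctx B) s :=
  match pselect (A s (sval v)) with
  | left vA => inl (exist _ (sval v) vA)
  | right nvA =>
      inr (exist _ (sval v) (or_ind (fun vA => False_ind _ (nvA vA)) id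
                               (CAB s (sval v) (svalP v))))
  end.

Definition incl_var V (A B : vset V) (AB : forall s, A s `<=` B s) s
    (v : vset_ctx A s) : vset_ctx B s :=
  exist _ (sval v) (AB s (sval v) (svalP v)).

(** * Derivability *)

Definition theory := sequent -> Prop.

(* T has at most kappa axioms.  This is [T #<= [set: kappa]], written out
   because sequents form a larger universe than the one of [set]. *)
Definition theory_card_le (T : theory) : Prop :=
  exists code : sequent -> kappa,
    forall sigma tau, T sigma -> T tau -> code sigma = code tau -> sigma = tau.

Section Derivations.
Variable T : theory.

(* [derives phi psi] is the derivability from T of the sequent phi |-_X psi. *)
Inductive derives : forall X : ctx, formula X -> formula X -> Prop :=
| D_axiom (sigma : sequent) : T sigma -> derives (antecedent sigma) (succedent sigma)
| D_id X (phi : formula X) : derives phi phi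
| D_cut X (phi psi theta : formula X) :
    derives phi psi -> derives psi theta -> derives phi theta
| D_subst (X Y : ctx) (sigma : subst X Y) (phi psi : formula X) :
    derives phi psi -> derives (fsubst phi sigma) (fsubst psi sigma)
| D_eq_refl (X : ctx) s (x : X s) : derives (Top X) (Eq (Var x) (Var x))
(* (x = y) /\ phi[x/w] |- phi[y/w], for tuples of variables x, y, w *)
| D_eq_subst (Z W : ctx) (phi : formula (ctx_add Z W))
    (x y : forall s, W s -> Z s) :
    let inst (u : forall s, W s -> Z s) : subst (ctx_add Z W) Z :=
      fun s v => match v with inl z => Var z | inr w => Var (u s w) end in
    derives
      (Conj (And (vars_small W) (fun w : {s & W s} =>
                Eq (Var (x _ (projT2 w))) (Var (y _ (projT2 w)))))
            (fsubst phi (inst x)))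
      (fsubst phi (inst y))
| D_and_elim X I (I_small : small I) (phi : I -> formula X) i :
    derives (And I_small phi) (phi i)
| D_and_intro X I (I_small : small I) (phi : formula X)
    (psi : I -> formula X) :
    (forall i, derives phi (psi i)) -> derives phi (And I_small psi)
| D_or_intro X I (phi : I -> formula X) i : derives (phi i) (Or phi)
| D_or_elim X I (phi : I -> formula X) (theta : formula X) :
    (forall i, derives (phi i) theta) -> derives (Or phi) theta
| D_ex_elim X Y (phi : formula (ctx_add X Y)) (psi : formula X) :
    derives phi (weaken Y psi) -> derives (Ex phi) psi
| D_ex_intro X Y (phi : formula (ctx_add X Y)) (psi : formula X) :
    derives (Ex phi) psi -> derives phi (weaken Y psi)
| D_distr X I (phi : formula X) (psi : I -> formula X) :
    derives (Conj phi (Or psi)) (Or (fun i => Conj phi (psi i)))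
| D_frobenius X Y (phi : formula X) (psi : formula (ctx_add X Y)) :
    derives (Conj phi (Ex psi)) (Ex (Conj (weaken Y phi) psi))
| D_T (gamma : Type) (V : var_tree gamma)
    (phi : forall f : kseq kappa gamma, formula (vset_ctx (vt_ctx V f)))
    (B : set (kseq kappa gamma)) :
    is_bar B ->
    (forall f, derives (phi f)
       (Or (fun g : {g | child f g} =>
          Ex (rename (split_var (vt_child_sub (V := V) (svalP g)))
                (phi (sval g)))))) ->
    (forall f (f_lim : is_limit (len f)),
       let conj := And (seg_small (len f)) (fun alpha : seg (len f) =>
         rename (incl_var (vt_limit_sub (V := V) f_lim (svalP alpha)))
           (phi (restr f (val alpha)))) in
       derives (phi f) conj /\ derives conj (phi f)) ->
    derives (phi knil)
      (Or (fun f : {f | minimal_in B f} =>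
         Ex (And (seg_small (len (sval f)))
           (fun beta : seg (len (sval f)) =>
              rename
                (split_var (vt_path_sub (V := V) (f := sval f)
                              (alpha := ksucc (val beta))))
                (phi (restr (sval f) (ksucc (val beta)))))))).

End Derivations.

Definition consistent (T : theory) : Prop :=
  ~ derives T (Top ctx0) (Bot ctx0).

End Syntax.

(** * Beth models *)

Section Trees.
Variables (kappa : regularCardinal) (d : Order.disp_t) (P : porderType d).

Definition is_tree : Prop :=
  forall x : P, wo_chain (<=%O : rel P) [pred y | y < x].

(* The order type of the set of predecessors of x is beta. *)
Definition has_level (x : P) (beta : kappa) : Prop :=
  exists h : {y : P | y < x} -> seg beta,
    bijective h /\ forall y z, (val (h y) <= val (h z)) = (val y <= val z).

Definition has_height : Prop :=
  (forall x : P, exists beta, has_level x beta) /\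
  (forall beta, exists x : P, has_level x beta).

Definition is_branch (b : set P) : Prop :=
  total_on b (<=%O) /\
  forall c : set P, total_on c (<=%O) -> b `<=` c -> c = b.

End Trees.

Section BethModels.
Variables (kappa : regularCardinal) (Sigma : signature kappa).

(* The transition maps are required to preserve the function symbols, i.e. to
   be homomorphisms of structures, as is needed for the values of terms to be
   compatible with the functor D. *)
Record beth_structure := BethStructure {
  bm_disp : Order.disp_t;
  bm_tree : porderType bm_disp;
  bm_is_tree : is_tree bm_tree;
  bm_height : has_height kappa bm_tree;
  bm_branches : forall b : set bm_tree, is_branch b -> b #= [set: kappa];
  bm_dom : bm_tree -> sorts Sigma -> Type;
  bm_tr : forall k l : bm_tree, k <= l -> forall s, bm_dom k s -> bm_dom l s;
  bm_tr_id : forall k (kk : k <= k) s (x : bm_dom k s), bm_tr kk x = x;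
  bm_tr_comp : forall k l m (kl : k <= l) (lm : l <= m) (km : k <= m) s
    (x : bm_dom k s), bm_tr lm (bm_tr kl x) = bm_tr km x;
  bm_fun : forall k (f : fun_sym Sigma),
    (forall i : seg (len (fdom f)), bm_dom k (kat i)) -> bm_dom k (fcod f);
  bm_rel : forall k (R : rel_sym Sigma),
    (forall i : seg (len (rdom R)), bm_dom k (kat i)) -> Prop;
  bm_fun_tr : forall k l (kl : k <= l) (f : fun_sym Sigma) c,
    bm_tr kl (@bm_fun k f c) = @bm_fun l f (fun i => bm_tr kl (c i));
  bm_rel_tr : forall k l (kl : k <= l) (R : rel_sym Sigma) c,
    @bm_rel k R c -> @bm_rel l R (fun i => bm_tr kl (c i))
}.

Section Forcing.
Variable M : beth_structure.
Notation tree := (bm_tree M).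

Definition env (k : tree) (X : sorts Sigma -> Type) : Type :=
  forall s, X s -> bm_dom k s.

Definition env_tr (k l : tree) (kl : k <= l) X (d : env k X) : env l X :=
  fun s x => bm_tr kl (d s x).

Definition env_add (k : tree) (X Y : ctx Sigma) (d : env k X) (e : env k Y) :
    env k (ctx_add X Y) :=
  fun s v => match v with inl x => d s x | inr y => e s y end.

Fixpoint eval (k : tree) X (d : env k X) s (t : term X s) : bm_dom k s :=
  match t with
  | Var s x => d s x
  | App f ts => bm_fun (fun i => eval d (ts i))
  end.

(* Every branch through k has an element l >= k satisfying Q. *)
Definition barred (k : tree) (Q : forall l : tree, k <= l -> Prop) : Prop :=
  forall b : set tree, is_branch b -> b k ->
    exists l : tree, b l /\ exists kl : k <= l, Q l kl.

Fixpoint forces (X : ctx Sigma) (phi : formula X) :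
    forall k : tree, env k X -> Prop :=
  match phi in formula X return forall k : tree, env k X -> Prop with
  | Rel X R t => fun k d =>
      barred (fun l (kl : k <= l) =>
        @bm_rel M l R (fun i => eval (env_tr kl d) (t i)))
  | Eq X s t u => fun k d =>
      barred (fun l (kl : k <= l) =>
        eval (env_tr kl d) t = eval (env_tr kl d) u)
  | And X J _ phi => fun k d => forall i, forces (phi i) d
  | Or X J phi => fun k d =>
      barred (fun l (kl : k <= l) => exists i, forces (phi i) (env_tr kl d))
  | Ex X Y phi => fun k d =>
      barred (fun l (kl : k <= l) =>
        exists e : env l Y, forces phi (env_add (env_tr kl d) e))
  end.

Definition forces_sequent (sigma : sequent Sigma) : Prop :=
  forall (k : tree) (d : env k (sctx sigma)),
    forces (antecedent sigma) d -> forces (succedent sigma) d.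

Definition beth_model (T : theory Sigma) : Prop :=
  (forall sigma, T sigma -> forces_sequent sigma) /\
  (forall (k : tree) (d : env k (ctx0 Sigma)), ~ forces (Bot (ctx0 Sigma)) d).

End Forcing.
End BethModels.

(* Main.v *)
Require Import Defs.
From mathcomp Require Import all_boot all_order.
From mathcomp Require Import boolp classical_sets functions cardinality.

Set Implicit Arguments.
Unset Strict Implicit.
Unset Printing Implicit Defensive.
Import Order.TTheory.

Local Open Scope classical_set_scope.
Local Open Scope card_scope.
Local Open Scope order_scope.

(** A consistent theory even has an ordinary model, and an ordinary model is a
    Beth model over the linear tree kappa, which has a single branch.  The
    model is a term model along one branch of a tree of attempts to build it.
    A node of length beta is a sequence of beta claims (formulas of the theory
    with names substituted for their variables): at level beta the bookkeeping
    selects either a claim made earlier, of which a conjunct, a disjunct or an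
    instance at new names is then claimed, or an instance of an axiom whose
    antecedent is provable at the node, whose succedent is then claimed.  The
    formula of a node is the conjunction of its claims, or falsity if a move
    was not legal.  Rule T applies to this tree: were every branch to reach an
    inconsistent node, the theory would be inconsistent.  So along some branch
    all nodes are consistent, hence all moves legal, and the terms in the names
    of this branch, modulo provable equality, form a model. *)

Lemma dfunext (A : Type) (B : A -> Type) (f g : forall x, B x) :
  (forall x, f x = g x) -> f = g.
Proof. exact: functional_extensionality_dep. Qed.

(** The induced equality of first components is a loop at [x], hence [erefl] by proof irrelevance,
    and the transport along it vanishes. *)
Lemma sigT_inj2 (T : Type) (P : T -> Type) x (a b : P x) : existT P x a = existT P x b -> a = b.
Proof.
by move=> e; have := projT2_eq e; rewrite (Prop_irrelevance (projT1_eq e) erefl).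
Qed.

(** * Cardinal arithmetic below kappa *)

Section Cardinals.
Variable kappa : regularCardinal.

Definition embeds (A : Type) : Prop := exists f : A -> kappa, injective f.

Lemma card_le_embeds (A : Type) : [set: A] #<= [set: kappa] -> embeds A.
Proof.
case/card_leP => f; exists (fun a => val (f (to_setT a))) => x y /val_inj e.
by have /(f_equal val) := inj (in_setT _) (in_setT _) e.
Qed.

Lemma embeds_inj (A B : Type) (f : A -> B) : injective f -> embeds B -> embeds A.
Proof. by move=> fi [g gi]; exists (g \o f); exact: inj_comp. Qed.

Lemma lt_wf : well_founded (fun a b : kappa => a < b).
Proof. by move=> b; elim/kappa_ind: b => b IH; constructor. Qed.

(** Transfinite recursion picks at each stage an element of [A] not picked before. If it never
    stops, [kappa] embeds in [A]; if it returns [None] at [beta], the stages below [beta] have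
    exhausted [A]. *)
Lemma small_seg (A : Type) : small kappa A ->
  exists beta (g : A -> seg (kappa := kappa) beta), injective g.
Proof.
move=> sA.
pose fresh (beta : kappa) (rec : forall alpha : kappa, alpha < beta -> option A) a :=
  forall alpha (h : alpha < beta), rec alpha h <> Some a.
pose F (beta : kappa) (rec : forall alpha : kappa, alpha < beta -> option A) : option A :=
  match pselect (exists a, fresh beta rec a) with
  | left e => Some (sval (cid e)) | right _ => None end.
pose g := Fix lt_wf (fun _ => option A) F.
have gE beta : g beta = F beta (fun alpha _ => g alpha).
  rewrite /g Fix_eq // => x f1 f2 ef; congr F.
  by apply: functional_extensionality_dep => y; apply: functional_extensionality_dep => z.
have [[beta gN]|gS] := pselect (exists beta, g beta = None).
  have cov a : exists alpha : seg beta, g (val alpha) = Some a.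
    move: gN; rewrite gE /F; case: pselect => // nE _.
    apply: contrapT => na; apply: nE; exists a => alpha h e.
    by apply: na; exists (exist _ alpha h).
  have [h hP] := choice cov.
  exists beta, h => x y e; have := hP x; rewrite e hP; by case.
case/negP: sA.
have tot beta : exists a, g beta = Some a.
  by case e: (g beta) => [a|]; [exists a | case: gS; exists beta].
have [h hP] := choice tot.
apply: (@card_le_injective _ _ h) => x y exy.
wlog xy : x y exy / x < y => [th|].
  by case: (ltgtP x y) => // ?; [exact: th | symmetry; apply: th].
have := hP y; rewrite gE /F; case: pselect => // e [eh].
by case: (svalP (cid e) x xy); rewrite eh hP exy.
Qed.

Lemma small_embeds (A : Type) : small kappa A -> embeds A.
Proof.
by case/small_seg => beta [g gi]; exists (val \o g); apply: inj_comp => //; exact: val_inj.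
Qed.

(** Were [h] unbounded, [kappa] would embed in the sum of the segments below the [ksucc (h i)],
    which is small by regularity. *)
Lemma small_sup (I : Type) (h : I -> kappa) : small kappa I ->
  exists beta, forall i, h i < beta.
Proof.
move=> sI; apply: contrapT => nb.
have big beta : exists i, beta < ksucc (h i).
  apply: contrapT => nb'; apply: nb; exists beta => i.
  rewrite ltNge; apply/negP => le; apply: nb'; exists i.
  exact: le_lt_trans le (lt_ksucc _).
have [c cP] := choice big.
have : small kappa {i & seg (ksucc (h i))}.
  by apply: rc_regular => // i; exact: seg_small.
case/negP; apply: (@card_le_injective _ _
  (fun beta => existT (fun i => seg (ksucc (h i))) (c beta) (exist _ beta (cP beta)))).
by move=> x y /(f_equal (fun p : {i & seg (ksucc (h i))} => val (projT2 p))).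
Qed.

Lemma ksucc_le (alpha beta : kappa) : alpha < beta -> ksucc alpha <= beta.
Proof. by move=> ab; have [_] := leastP (above_neq0 alpha); apply. Qed.

Lemma lt_ksuccE (alpha beta : kappa) : (alpha < ksucc beta) = (alpha <= beta).
Proof.
apply/idP/idP => [|le]; last exact: le_lt_trans le (lt_ksucc _).
by apply: contraTT; rewrite -!(ltNge, leNgt) => /ksucc_le.
Qed.

Lemma ksucc_lt (alpha beta : kappa) : (ksucc alpha < ksucc beta) = (alpha < beta).
Proof.
rewrite lt_ksuccE; apply/idP/idP => [|/ksucc_le //]; exact: lt_le_trans (lt_ksucc _).
Qed.

Lemma ksucc_inj : injective (@ksucc kappa).
Proof.
by move=> a b e; apply/eqP; case: ltgtP => // ; rewrite -ksucc_lt e ltxx.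
Qed.

Lemma kzero_le (beta : kappa) : kzero kappa <= beta.
Proof. by have [_] := leastP (kappa_neq0 kappa); apply. Qed.

Lemma limit_ksucc (beta : kappa) : is_limit beta ->
  forall alpha, alpha < beta -> ksucc alpha < beta.
Proof. by move=> [_ nS] alpha /ksucc_le; rewrite le_eqVlt => /predU1P [/esym/nS|]. Qed.

Hypothesis kappa_exp : [set: kseq kappa kappa] #= [set: kappa].

Lemma kseq_embeds : embeds (kseq kappa kappa).
Proof. by apply: card_le_embeds; move: kappa_exp; rewrite card_eq_le => /andP[]. Qed.

(** Through an injection of [Z] into a segment, a function becomes a sequence of length below
    [kappa], padded with [kzero] off the image; [kappa_exp] bounds the number of these. *)
Lemma fun_embeds (Z B : Type) : small kappa Z -> embeds B -> embeds (Z -> B).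
Proof.
move=> /small_seg [beta [j ji]] [c ci].
pose enc (f : Z -> B) : kseq kappa kappa :=
  existT (fun b => seg b -> kappa) beta (fun i =>
    match pselect (exists z, j z = i) with
    | left e => c (f (sval (cid e))) | right _ => kzero kappa end).
apply: (@embeds_inj _ _ enc) kseq_embeds => f g efg.
apply/funext => z.
have /(f_equal (fun h => h (j z))) := existT_inj2 efg.
case: pselect => [e|[]]; last by exists z.
by case: (cid e) => z' /= /ji -> /ci.
Qed.

Lemma prod_embeds (A B : Type) : embeds A -> embeds B -> embeds (A * B).
Proof.
move=> [f fi] [g gi].
have : embeds (bool -> kappa).
  by apply: fun_embeds; [exact: small_finType | exists id].
apply: (@embeds_inj _ _ (fun p b => if b then f p.1 else g p.2)).
move=> [a b] [a' b'] e; congr pair.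
  by apply: fi; exact: (f_equal (fun h => h true) e).
by apply: gi; exact: (f_equal (fun h => h false) e).
Qed.

Lemma sum_embeds (A B : Type) : embeds A -> embeds B -> embeds (A + B).
Proof.
move=> [f fi] [g gi].
have : embeds (bool * kappa).
  by apply: prod_embeds; [apply: small_embeds; exact: small_finType | exists id].
apply: (@embeds_inj _ _ (fun p => match p with inl a => (true, f a) | inr b => (false, g b) end)).
by move=> [a|a] [b|b] // [] => [/fi|/gi] ->.
Qed.

(** Stage [j (q, eps)] is devoted to [q]. For fixed [q] there are [kappa] many such stages, too many
    to fit below [ksucc delta]. The default [q0] fills the stages that code no pair. *)
Lemma bookkeeping (Q : Type) : Q -> embeds Q ->
  exists bk : kappa -> Q, forall q delta, exists beta, delta < beta /\ bk beta = q.
Proof.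
move=> q0 eQ; have [j ji] : embeds (Q * kappa) by apply: prod_embeds => //; exists id.
exists (fun beta => match pselect (exists p, j p = beta) with
  | left e => (sval (cid e)).1 | right _ => q0 end) => q delta.
have [eps leps] : exists eps, delta < j (q, eps).
  apply: contrapT => nb.
  have le eps : j (q, eps) < ksucc delta.
    rewrite lt_ksuccE leNgt; apply/negP => ?; apply: nb; by exists eps.
  case/negP: (seg_small (ksucc delta)).
  apply: (@card_le_injective _ _ (fun eps => exist _ (j (q, eps)) (le eps))).
  by move=> x y /(f_equal val) /= /ji [].
exists (j (q, eps)); split=> //; case: pselect => [e|[]]; last by exists (q, eps).
by case: (cid e) => p /= /ji ->.
Qed.

End Cardinals.

(** * Substitution and derived rules *)

Section Substitution.
Variables (kappa : regularCardinal) (Sigma : signature kappa).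
Notation sorts := (sorts Sigma).
Implicit Types X Y Z : ctx Sigma.

Lemma subst_ext (X Y : sorts -> Type) (f g : subst X Y) :
  (forall s x, f s x = g s x) -> f = g.
Proof. by move=> e; apply: dfunext => s; apply: dfunext => x. Qed.

Lemma tsubst_comp (X Y Z : sorts -> Type) (f : subst X Y) (g : subst Y Z) s (t : term X s) :
  tsubst g (tsubst f t) = tsubst (fun s x => tsubst g (f s x)) t.
Proof.
by elim: t => //= F ts IH; congr App; apply: dfunext => i.
Qed.

Lemma tsubst_id (X : sorts -> Type) s (t : term X s) : tsubst (fun s x => Var x) t = t.
Proof. by elim: t => //= F ts IH; congr App; apply: dfunext => i. Qed.

Lemma fsubst_comp X (phi : formula X) : forall Y Z (f : subst X Y) (g : subst Y Z),
  fsubst (fsubst phi f) g = fsubst phi (fun s x => tsubst g (f s x)).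
Proof.
elim: phi => {X} [X R t|X s t u|X I sI phi IH|X I phi IH|X W phi IH] Y Z f g /=.
- by congr Rel; apply: dfunext => i; rewrite tsubst_comp.
- by rewrite !tsubst_comp.
- by congr And; apply: dfunext => i.
- by congr Or; apply: dfunext => i.
- rewrite IH; congr Ex; congr fsubst; apply: subst_ext => s [x|w] //=.
  by rewrite !tsubst_comp.
Qed.

Lemma fsubst_id X (phi : formula X) : fsubst phi (fun s x => Var x) = phi.
Proof.
elim: phi => {X} [X R t|X s t u|X I sI phi IH|X I phi IH|X W phi IH] /=.
- by congr Rel; apply: dfunext => i; rewrite tsubst_id.
- by rewrite !tsubst_id.
- by congr And; apply: dfunext => i.
- by congr Or; apply: dfunext => i.
- by rewrite -[in RHS]IH; congr Ex; congr fsubst; apply: subst_ext => s [x|w].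
Qed.

Lemma fsubst_Top X Y (f : subst X Y) : fsubst (Top X) f = Top Y.
Proof. by congr And; apply: dfunext => -[]. Qed.

Lemma fsubst_Bot X Y (f : subst X Y) : fsubst (Bot X) f = Bot Y.
Proof. by congr Or; apply: dfunext => -[]. Qed.

Lemma fsubst_Conj X Y (f : subst X Y) phi psi :
  fsubst (Conj phi psi) f = Conj (fsubst phi f) (fsubst psi f).
Proof. by congr And; apply: dfunext => -[]. Qed.

Definition copair (X Y Z : sorts -> Type) (f : subst X Z) (g : subst Y Z) :
    subst (fun s => X s + Y s)%type Z :=
  fun s v => match v with inl x => f s x | inr y => g s y end.

End Substitution.

Section Derived.
Variables (kappa : regularCardinal) (Sigma : signature kappa) (T : theory Sigma).
Notation sorts := (sorts Sigma).
Implicit Types X Y Z : ctx Sigma.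
Notation "phi |- psi" := (derives T phi psi) (at level 70).

Lemma conj_introP X (theta phi psi : formula X) :
  theta |- phi -> theta |- psi -> theta |- Conj phi psi.
Proof. by move=> h1 h2; apply: D_and_intro => -[]. Qed.

Lemma conj_elim1 X (phi psi : formula X) : Conj phi psi |- phi.
Proof. exact: (D_and_elim T _ (fun b : bool => if b then phi else psi) true). Qed.

Lemma conj_elim2 X (phi psi : formula X) : Conj phi psi |- psi.
Proof. exact: (D_and_elim T _ (fun b : bool => if b then phi else psi) false). Qed.

Lemma top_introP X (phi : formula X) : phi |- Top X.
Proof. by apply: D_and_intro => -[]. Qed.

Lemma bot_elimP X (phi : formula X) : Bot X |- phi.
Proof. by apply: D_or_elim => -[]. Qed.

(* The distributivity rule turns a disjunction proved from [phi] into a case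
   analysis that keeps the hypothesis [phi]. *)
Lemma or_cases X I (phi : formula X) (psi : I -> formula X) theta :
  phi |- Or psi -> (forall i, Conj phi (psi i) |- theta) -> phi |- theta.
Proof.
move=> h1 h2; apply: (@D_cut _ _ _ _ _ (Conj phi (Or psi))).
  by apply: conj_introP => //; exact: D_id.
apply: D_cut (D_distr _ _ _) _; exact: D_or_elim.
Qed.

Lemma ex_cases X Y (phi : formula X) (psi : formula (ctx_add X Y)) theta :
  phi |- Ex psi -> Conj (weaken Y phi) psi |- weaken Y theta -> phi |- theta.
Proof.
move=> h1 h2; apply: (@D_cut _ _ _ _ _ (Conj phi (Ex psi))).
  by apply: conj_introP => //; exact: D_id.
apply: D_cut (D_frobenius _ _ _) _; exact: D_ex_elim.
Qed.

(** The rule gives [psi |- weaken Y (Ex psi)]; substituting [e] for the bound block undoes the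
    weakening. *)
Lemma ex_witness X Y (psi : formula (ctx_add X Y)) (e : subst Y X) :
  fsubst psi (copair (fun s x => Var x) e : subst (ctx_add X Y) X) |- Ex psi.
Proof.
have := D_subst (copair (fun s x => Var x) e : subst (ctx_add X Y) X)
  (D_ex_intro (D_id T (Ex psi))).
rewrite /weaken /rename fsubst_comp.
by rewrite (_ : (fun s x => _) = fun s x => Var x) ?fsubst_id.
Qed.

(** The equality rule speaks of tuples of variables only. It is applied over two copies of [X],
    which are then replaced by [d] and [d']. *)
Lemma leibniz X Z (d d' : subst X Z) (phi : formula X) theta :
  (forall s (x : X s), theta |- Eq (d s x) (d' s x)) ->
  theta |- fsubst phi d -> theta |- fsubst phi d'.
Proof.
move=> hd hphi.
pose W := ctx_add X X.
pose x s (v : X s) : W s := inl v.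
pose y s (v : X s) : W s := inr v.
have := D_subst (copair d d' : subst W Z)
  (D_eq_subst T (rename (fun s v => inr v : ctx_add W X s) phi) x y).
cbv zeta; rewrite fsubst_Conj /rename !fsubst_comp; apply: D_cut.
apply: conj_introP => //; apply: D_and_intro => -[s v]; exact: hd.
Qed.

Lemma eq_reflP X (theta : formula X) s (t : term X s) : theta |- Eq t t.
Proof.
(* A context with one variable, of sort [s]: the variables of sort [s'] are the proofs of
   [s = s']. *)
have sm : small kappa {s' & s = s'}.
  apply: (@small_inj _ _ unit (fun=> tt)) (small_finType _ _).
  by move=> [s1 e1] [s2 e2] _; case: _ / e1; case: _ / e2.
pose W := Ctx sm : ctx Sigma.
pose d : subst W X := fun s' (e : s = s') => eq_rect _ (term X) t _ e.
have := D_subst d (D_eq_refl T (erefl s : W s)).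
rewrite fsubst_Top /=; apply: D_cut; exact: top_introP.
Qed.

(** Leibniz for an equation between two variables of sort [s], told apart by a boolean. Symmetry and
    transitivity are instances. *)
Lemma eq_congr2 X theta s (t t' u u' : term X s) :
  theta |- Eq t t' -> theta |- Eq u u' -> theta |- Eq t u -> theta |- Eq t' u'.
Proof.
move=> ht hu htu.
have sm : small kappa {s' & {b : bool | s = s'}}.
  apply: (@small_inj _ _ bool (fun p => sval (projT2 p))) (small_finType _ _).
  by move=> [s1 [b e1]] [s2 [b' e2]] /= ->; case: _ / e1; case: _ / e2.
pose W := Ctx sm : ctx Sigma.
pose d (t u : term X s) : subst W X := fun s' e =>
  eq_rect _ (term X) (if sval e then t else u) _ (proj2_sig e).
pose w b : W s := exist _ b erefl.
refine (@leibniz W X (d t u) (d t' u') (Eq (Var (w true)) (Var (w false))) _ _ htu).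
by move=> s' [[] e]; rewrite /d /=; case: _ / e.
Qed.

Lemma eq_symP X theta s (t u : term X s) : theta |- Eq t u -> theta |- Eq u t.
Proof. by move=> h; apply: (eq_congr2 h) (eq_reflP _ _) (eq_reflP _ _). Qed.

Lemma eq_transP X theta s (t u v : term X s) :
  theta |- Eq t u -> theta |- Eq u v -> theta |- Eq t v.
Proof. by move=> h1 h2; apply: (eq_congr2 (eq_reflP _ _) h2). Qed.

Lemma arity_small (a : kseq kappa sorts) :
  small kappa {s & {i : seg (len a) | kat i = s}}.
Proof.
apply: (@small_inj _ _ _ (fun p => sval (projT2 p))) (seg_small (len a)).
move=> [s [i e]] [s' [i' e']] /= ii; case: _ / ii e' => e'.
by case: _ / e; case: _ / e'.
Qed.

(** The argument places of a symbol turned into variables, so that tuples of arguments become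
    substitutions and [leibniz] applies to them. *)
Definition arity_ctx (a : kseq kappa sorts) : ctx Sigma := Ctx (arity_small a).

Definition arity_var (a : kseq kappa sorts) (i : seg (len a)) : arity_ctx a (kat i) :=
  exist _ i erefl.

Definition arity_fam (a : kseq kappa sorts) (D : sorts -> Type) (c : forall i : seg (len a), D (kat i)) :
    forall s, arity_ctx a s -> D s :=
  fun s w => eq_rect _ D (c (sval w)) _ (proj2_sig w).

Lemma rel_congr X theta (R : rel_sym Sigma) (t u : forall i : seg (len (rdom R)), term X (kat i)) :
  (forall i, theta |- Eq (t i) (u i)) -> theta |- Rel t -> theta |- Rel u.
Proof.
move=> htu ht.
refine (@leibniz (arity_ctx (rdom R)) X (arity_fam t) (arity_fam u)
  (Rel (fun i => Var (arity_var i))) _ _ ht).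
by move=> s [i e]; rewrite /arity_fam /=; case: _ / e.
Qed.

Lemma app_congr X theta (f : fun_sym Sigma) (t u : forall i : seg (len (fdom f)), term X (kat i)) :
  (forall i, theta |- Eq (t i) (u i)) -> theta |- Eq (App t) (App u).
Proof.
move=> htu; pose A := arity_ctx (fdom f).
(* Two copies of the places stand for the two sides of the equation. Only the right copy changes
   from [t] to [u], starting from reflexivity. *)
refine (@leibniz (ctx_add A A) X (copair (arity_fam t) (arity_fam t))
  (copair (arity_fam t) (arity_fam u))
  (Eq (App (fun i => Var (inl (arity_var i) : ctx_add A A _)))
      (App (fun i => Var (inr (arity_var i) : ctx_add A A _)))) _ _ (eq_reflP _ _)).
move=> s [w|[i e]] /=; first exact: eq_reflP.
by rewrite /arity_fam /=; case: _ / e.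
Qed.

End Derived.

(** * Names and claims *)

Section Names.
Variables (kappa : regularCardinal) (Sigma : signature kappa).
Notation sorts := (sorts Sigma).

(* The name [(alpha, i)] is the [i]-th variable introduced at level [alpha]. *)
Definition name (s : sorts) : Type := (kappa * kappa)%type.

Definition unvar (V : sorts -> Type) s (t : term V s) : option (V s) :=
  match t with Var s v => Some v | App _ _ => None end.

Lemma Var_inj (V : sorts -> Type) s : injective (@Var kappa Sigma V s).
Proof. by move=> v w /(f_equal (@unvar _ _)) []. Qed.

Definition nsub (Z : sorts -> Type) (nm : forall s, Z s -> name s) : subst Z name :=
  fun s z => Var (nm s z).

(** A partial left inverse [g] is defined by recursion on terms over names, which avoids inverting
    equalities between dependently typed applications. *)
Lemma tsubst_inj (Z : sorts -> Type) (nm : forall s, Z s -> name s) :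
  (forall s, injective (nm s)) -> forall s, injective (@tsubst _ _ _ _ (nsub nm) s).
Proof.
move=> nmi.
pose fix g s (t : term name s) : option (term Z s) :=
  match t in term _ s return option (term Z s) with
  | Var s v => match pselect (exists z, nm s z = v) with
      | left e => Some (Var (sval (cid e))) | right _ => None end
  | App f ts =>
      match pselect (exists us, forall i, g _ (ts i) = Some (us i)) with
      | left e => Some (App (sval (cid e))) | right _ => None end
  end.
have gK s t : g s (tsubst (nsub nm) t) = Some t.
  elim: t => {s} [s z|f ts IH] /=.
    case: pselect => [e|[]]; last by exists z.
    by case: (cid e) => z' /= /nmi ->.
  case: pselect => [e|[]]; last by exists ts.
  case: (cid e) => us /= hus; congr (Some (App _)); apply: dfunext => i.
  by have := hus i; rewrite IH => -[].
by move=> s t u /(f_equal (@g s)); rewrite !gK => -[].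
Qed.

Lemma tsubst_nsub_Var (Z : sorts -> Type) (nm : forall s, Z s -> name s) s (t : term Z s) v :
  tsubst (nsub nm) t = Var v -> exists z, t = Var z /\ nm s z = v.
Proof.
case: t v => {s} [s z|f ts] v; last by move/(f_equal (@unvar _ _)).
by move=> /(@Var_inj _ _ _ _) <-; exists z.
Qed.

(** The substitution is kept beside the formula instead of being carried out: with [kappa * kappa]
    names at each sort, the names do not in general form a context. *)
Record claim := Claim {
  clctx : ctx Sigma;
  clform : formula clctx;
  clsub : subst clctx name
}.
Arguments clsub : clear implicits.

Definition trivial : claim :=
  @Claim (ctx0 Sigma) (Top _) (fun s (x : void) => match x with end).

Section Named.
Variables (Z : ctx Sigma) (nm : forall s, Z s -> name s).

Definition named X (d : subst X Z) : subst X name := fun s x => tsubst (nsub nm) (d s x).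

Definition supported (L : claim) : Prop := exists d, named d = clsub L.

(** The claim read back over the small context [Z]. The default [Top] is harmless, since all claims
    of a legal node are supported ([legal_supported]). *)
Definition claim_at (L : claim) : formula Z :=
  match pselect (supported L) with
  | left e => fsubst (clform L) (sval (cid e)) | right _ => Top Z end.

(** Injective naming makes the preimage of the substitution unique, so the one chosen by [cid] is
    [d]. *)
Lemma claim_atE (nmi : forall s, injective (@nm s)) X (phi : formula X) (d : subst X Z) :
  claim_at (Claim phi (named d)) = fsubst phi d.
Proof.
rewrite /claim_at; case: pselect => [e|[]]; last by exists d.
case: (cid e) => d' /= ed; congr fsubst; apply: subst_ext => s x.
apply: (tsubst_inj nmi).
exact: (f_equal (fun h : subst X name => h s x) ed).
Qed.

End Named.

Section Renaming.
Variables (Z Z' : ctx Sigma) (nm : forall s, Z s -> name s) (nm' : forall s, Z' s -> name s).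
Variable r : forall s, Z s -> Z' s.
Hypothesis rE : forall s z, nm' (r z) = nm z :> name s.

Definition rsub : subst Z Z' := fun s z => Var (r z).

Lemma named_rename X (d : subst X Z) :
  named nm' (fun s x => tsubst rsub (d s x)) = named nm d.
Proof.
apply: subst_ext => s x; rewrite /named tsubst_comp.
have -> // : (fun s z => tsubst (nsub nm') (rsub z)) = nsub nm.
by apply: subst_ext => s' z; rewrite /= /nsub rE.
Qed.

Lemma supported_rename L : supported nm L -> supported nm' L.
Proof.
by move=> [d ed]; exists (fun s x => tsubst rsub (d s x)); rewrite named_rename.
Qed.

Lemma rename_claim (nmi : forall s, injective (@nm' s)) L : supported nm L ->
  rename r (claim_at nm L) = claim_at nm' L.
Proof.
rewrite {1}/claim_at; case: pselect => // e _; case: L e => X phi d e.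
case: (cid e) => d0 /= <-.
by rewrite /rename fsubst_comp -(claim_atE nmi) -named_rename.
Qed.

End Renaming.

Lemma newset_small (alpha : kappa) (L : claim) :
  small kappa {s & {v : name s | v.1 = alpha /\ exists x, clsub L s x = Var v}}.
Proof.
pose h (p : {s & {v : name s | v.1 = alpha /\ exists x, clsub L s x = Var v}}) :
    {s & clctx L s} :=
  let: existT s (exist v hv) := p in existT _ s (sval (cid (proj2 hv))).
apply: (@small_inj _ _ _ h) (vars_small (clctx L)).
move=> [s [v hv]] [s' [v' hv']] e.
have es : s = s' := f_equal (@projT1 _ _) e.
case: _ / es v' hv' e => v' hv' /(@sigT_inj2 _ (fun s => clctx L s)) /=.
case: (cid (proj2 hv)) => x /= ex; case: (cid (proj2 hv')) => x' /= ex' xx.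
have vv : v = v' by apply: (@Var_inj name s); rewrite -ex -ex' xx.
case: _ / vv hv' ex' => hv' _; congr existT; congr exist; exact: Prop_irrelevance.
Qed.

(** The names that [L] introduces when claimed at level [alpha]. A fresh name enters as the bare
    value of a variable of [L], which bounds their number by the context of [L]. *)
Definition newset alpha L : vset (kappa := kappa) name := VSet (newset_small alpha L).

Lemma vset_sub_small (A : vset (kappa := kappa) name) (P : forall s, set (name s)) :
  small kappa {s & {v : name s | vmem A v /\ P s v}}.
Proof.
pose h (p : {s & {v : name s | vmem A v /\ P s v}}) : {s & {v : name s | vmem A v}} :=
  let: existT s (exist v hv) := p in
  existT (fun s => {v : name s | vmem A v}) s (exist _ v (proj1 hv)).
apply: (@small_inj _ _ _ h) (vmem_small A).
move=> [s [v hv]] [s' [v' hv']] e.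
have es : s = s' := f_equal (@projT1 _ _) e.
case: _ / es v' hv' e => v' hv' /(@sigT_inj2 _ (fun s => {v : name s | vmem A v})) /(f_equal (@sval _ _)) /= vv.
by case: _ / vv hv' => hv'; congr existT; congr exist; exact: Prop_irrelevance.
Qed.

Definition vset_sub A P : vset (kappa := kappa) name := VSet (vset_sub_small A P).

Definition vnm (A : vset (kappa := kappa) name) : forall s, vset_ctx A s -> name s :=
  fun s v => sval v.

Lemma vnm_inj A s : injective (@vnm A s).
Proof.
by move=> [v hv] [v' hv'] /= e; case: _ / e hv' => hv'; congr exist; exact: Prop_irrelevance.
Qed.

End Names.
Arguments clsub {kappa Sigma} L s x : rename.

(** * Access to entries, restriction and one-step extension of sequences *)

Section Sequences.
Variables (kappa : regularCardinal) (gamma : Type) (m0 : gamma).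
Implicit Types (f g : kseq kappa gamma) (alpha beta : kappa).

(** The default [m0] beyond the length frees the index from its dependence on [f]. *)
Definition at_ f alpha : gamma :=
  match insub alpha : option (seg (len f)) with Some i => kat i | None => m0 end.

Lemma kat_at f (i : seg (len f)) : kat i = at_ f (val i).
Proof.
rewrite /at_; case: insubP => [j _ ej|]; first by congr kat; exact: val_inj.
by rewrite (valP i).
Qed.

Lemma kseq_ext f g : len f = len g ->
  (forall alpha, alpha < len f -> at_ f alpha = at_ g alpha) -> f = g.
Proof.
move=> e h; apply: kseq_eq => // i j eij; rewrite !kat_at -eij; apply: h; exact: (valP i).
Qed.

Lemma at_restr f alpha beta : alpha < beta -> at_ (restr f beta) alpha = at_ f alpha.
Proof.
move=> ab; rewrite /at_; case: insubP => [i ih ie|].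
  case: insubP => [j _ je|]; last by move: ih; rewrite lt_min => /andP [_ ->].
  by rewrite /kat /= /kat; congr (projT2 f _); apply: val_inj; rewrite /= ie je.
rewrite lt_min ab /= => nl; case: insubP => // j lj; by rewrite lj in nl.
Qed.

Lemma at_initseg (b : kappa -> gamma) alpha beta :
  alpha < beta -> at_ (initseg b beta) alpha = b alpha.
Proof.
by move=> ab; rewrite /at_; case: insubP => [i _ <- //|]; rewrite ab.
Qed.

Lemma restr_initseg (b : kappa -> gamma) alpha beta :
  alpha <= beta -> restr (initseg b beta) alpha = initseg b alpha.
Proof.
move=> ab; apply: kseq_ext => [|a]; rewrite len_restr // => lt.
by rewrite at_restr // !at_initseg // (lt_le_trans lt).
Qed.

Definition snoc f m : kseq kappa gamma :=
  existT (fun beta => seg beta -> gamma) (ksucc (len f))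
    (fun i => if val i < len f then at_ f (val i) else m).

Lemma at_snoc f m alpha : alpha < len f -> at_ (snoc f m) alpha = at_ f alpha.
Proof.
move=> lt; rewrite {1}/at_; case: insubP => [i _ ie|].
  by rewrite /kat /= ie lt.
by rewrite lt_ksuccE (ltW lt).
Qed.

Lemma at_snoc_len f m : at_ (snoc f m) (len f) = m.
Proof.
rewrite /at_; case: insubP => [i _ ie|]; first by rewrite /kat /= ie ltxx.
by rewrite lt_ksucc.
Qed.

Lemma restr_snoc f m alpha : alpha <= len f -> restr (snoc f m) alpha = restr f alpha.
Proof.
move=> le; have le' : alpha <= len (snoc f m) by rewrite (le_trans le) // ltW // lt_ksucc.
apply: kseq_ext => [|a]; rewrite !len_restr // => lt.
by rewrite !at_restr // at_snoc // (lt_le_trans lt).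
Qed.

Lemma child_snoc f m : child f (snoc f m).
Proof. by split => //; rewrite restr_snoc // restr_ge. Qed.

End Sequences.

(** * Beth models over the linear tree kappa *)

Section ConstantModel.
Variables (kappa : regularCardinal) (Sigma : signature kappa).
Notation sorts := (sorts Sigma).

Lemma kappa_is_tree : is_tree kappa.
Proof. by move=> x A _; exact: rc_wo. Qed.

Lemma kappa_height : has_height kappa kappa.
Proof.
have lev (x : kappa) : has_level (kappa := kappa) x x.
  by exists id; split=> //; exists id.
by split=> x; exists x.
Qed.

(** A total order is a chain itself, hence its only maximal chain. *)
Lemma kappa_branch (b : set kappa) : is_branch b <-> b = setT.
Proof.
have tot (c : set kappa) : total_on c (<=%O) by move=> x y _ _; apply/orP; exact: le_total.
split=> [[_ bmax]|->]; first by symmetry; exact: bmax.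
by split=> // c _; rewrite subTset.
Qed.

Variables (D : sorts -> Type)
  (F : forall f : fun_sym Sigma, (forall i : seg (len (fdom f)), D (kat i)) -> D (fcod f))
  (R : forall r : rel_sym Sigma, (forall i : seg (len (rdom r)), D (kat i)) -> Prop).

Lemma kappa_branches (b : set kappa) : is_branch b -> b #= [set: kappa].
Proof. by move/kappa_branch ->; exact: card_eqxx. Qed.

Definition constant_beth : beth_structure Sigma :=
  @BethStructure kappa Sigma _ kappa kappa_is_tree kappa_height kappa_branches
    (fun _ => D) (fun k l kl s x => x) (fun k kk s x => erefl)
    (fun k l m kl lm km s x => erefl) (fun k => F) (fun k => R)
    (fun k l kl f c => erefl) (fun k l kl r c h => h).

Fixpoint teval X (e : forall s, X s -> D s) s (t : term X s) : D s :=
  match t with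
  | Var s x => e s x
  | App f ts => F (fun i => teval e (ts i))
  end.

Definition eadd (X Y : ctx Sigma) (e : forall s, X s -> D s) (e' : forall s, Y s -> D s) :
    forall s, ctx_add X Y s -> D s :=
  fun s v => match v with inl x => e s x | inr y => e' s y end.

Fixpoint sat (X : ctx Sigma) (phi : formula X) : (forall s, X s -> D s) -> Prop :=
  match phi in formula X return (forall s, X s -> D s) -> Prop with
  | Rel X r t => fun e => R (fun i => teval e (t i))
  | Eq X s t u => fun e => teval e t = teval e u
  | And X J _ phi => fun e => forall i, sat (phi i) e
  | Or X J phi => fun e => exists i, sat (phi i) e
  | Ex X Y phi => fun e => exists e' : forall s, Y s -> D s, sat phi (eadd e e')
  end.

Lemma eval_constant (k : kappa) (X : sorts -> Type) (e : forall s, X s -> D s) s (t : term X s) :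
  eval (M := constant_beth) (k := k) e t = teval e t.
Proof. by elim: t => //= f ts IH; congr F; apply: dfunext => i. Qed.

(** The whole tree is the only branch and [k] lies on it, so being barred by a condition independent
    of the stage means that the condition holds. *)
Lemma barred_constant (k : kappa) (Q : forall l : kappa, k <= l -> Prop) (P : Prop) :
  (forall l kl, Q l kl <-> P) ->
  barred (M := constant_beth) (k := k) Q <-> P.
Proof.
move=> QP; split=> [h|p b _ bk].
  have bT : is_branch (setT : set kappa) by exact/kappa_branch.
  by case: (h setT bT Logic.I) => l [_] [kl] /QP.
by exists k; split=> //; exists (lexx k); apply/QP.
Qed.

Lemma forces_constant (X : ctx Sigma) (phi : formula X) :
  forall (k : kappa) (e : forall s, X s -> D s),
  forces (M := constant_beth) phi (k := k) e <-> sat phi e.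
Proof.
elim: phi => {X} [X r t|X s t u|X J sJ phi IH|X J phi IH|X Y phi IH] k e /=.
- apply: barred_constant => l kl.
  change (R (fun i => eval (M := constant_beth) (k := l) e (t i)) <-> R (fun i => teval e (t i))).
  have -> // : (fun i => eval (M := constant_beth) (k := l) e (t i)) = (fun i => teval e (t i)).
  by apply: dfunext => i; exact: eval_constant.
- apply: barred_constant => l kl.
  change (eval (M := constant_beth) (k := l) e t = eval (M := constant_beth) (k := l) e u <->
    teval e t = teval e u).
  by rewrite !eval_constant.
- by split=> h i; apply/IH; exact: h.
- by apply: barred_constant => l kl; split=> -[i h]; exists i; apply/(IH i l e).
- by apply: barred_constant => l kl; split=> -[e' h]; exists e'; apply/(IH l (eadd e e')).
Qed.

End ConstantModel.

(** * The tree of attempts and the model along a branch *)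

Section Tree.
Variables (kappa : regularCardinal) (Sigma : signature kappa) (T : theory Sigma).
Notation sorts := (sorts Sigma).
Notation "phi |- psi" := (derives T phi psi) (at level 70).
Notation claim := (claim Sigma).
Notation name := (@name kappa Sigma).

Variables (gamma : Type) (m0 : gamma) (lc : gamma -> claim).
Variable ax : kappa -> sequent Sigma.
Variable scode : forall c (A : vset (kappa := kappa) name), subst (sctx (ax c)) (vset_ctx A) -> kappa.
(** A task [inl (alpha, e)] treats the claim made at [alpha] with code [e]; a task
    [inr (c, (alpha, e))] applies axiom [c] to the substitution of code [e] into the names available
    at [alpha]. *)
Variable bk : kappa -> (kappa * kappa) + (kappa * (kappa * kappa)).

Definition realized L := exists m, lc m = L.

Hypothesis lc_m0 : lc m0 = trivial Sigma.
Hypothesis realized_ax : forall c d, realized (@Claim _ _ (sctx (ax c)) (succedent (ax c)) d).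
Hypothesis realized_And : forall X I (sI : small kappa I) (phi : I -> formula X) d i,
  realized (Claim (And sI phi) d) -> realized (Claim (phi i) d).
Hypothesis realized_Or : forall X I (phi : I -> formula X) d i,
  realized (Claim (Or phi) d) -> realized (Claim (phi i) d).
Hypothesis realized_Ex : forall X Y (phi : formula (ctx_add X Y)) d d',
  realized (Claim (Ex phi) d) -> realized (@Claim _ _ (ctx_add X Y) phi d').
Hypothesis ax_derives : forall c, antecedent (ax c) |- succedent (ax c).

Implicit Types (f g : kseq kappa gamma) (alpha beta : kappa).

Notation at_ := (@at_ kappa gamma m0).

(** * The names and the claims of a node *)

Definition fact f alpha : claim := lc (at_ f alpha).

Definition names f : vset (kappa := kappa) name :=
  vbigcup (seg_small (len f)) (fun i => newset (val i) (fact f (val i))).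

Lemma namesE f s (v : name s) :
  names f s v <-> v.1 < len f /\ exists x, clsub (fact f v.1) s x = Var v.
Proof.
split=> [[i [/= -> hx]]|[h1 h2]]; first by split; [exact: (valP i)|].
by exists (exist _ v.1 h1).
Qed.

Lemma fact_restr f alpha beta : alpha < beta -> fact (restr f beta) alpha = fact f alpha.
Proof. by move=> h; rewrite /fact at_restr. Qed.

Lemma names_restr f alpha s : names (restr f alpha) s `<=` names f s.
Proof.
move=> v /namesE [h1 h2]; apply/namesE; move: h1; rewrite lt_min => /andP [l1 l2].
by split=> //; rewrite fact_restr in h2.
Qed.

Lemma names_knil s v : ~ names knil s v.
Proof. by move/namesE => [+ _]; rewrite ltNge kzero_le. Qed.

(** The last claim of a node of length [ksucc beta] sits at level [beta], hence the successor. *)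
Definition new_names g : vset (kappa := kappa) name :=
  vset_sub (names g) (fun s v => ksucc v.1 = len g).

Lemma child_fact f g alpha : child f g -> alpha < len f -> fact g alpha = fact f alpha.
Proof. by move=> [_ fg] lt; rewrite -fg fact_restr. Qed.

Lemma names_child f g : child f g ->
  forall s, names g s = names f s `|` new_names g s.
Proof.
move=> fg s; apply/seteqP; split=> v.
  move=> gv; have /namesE [+ h2] := gv; rewrite (proj1 fg) lt_ksuccE le_eqVlt.
  case/predU1P => [e|lt]; first by right; split=> //; rewrite e (proj1 fg).
  by left; apply/namesE; rewrite -(child_fact fg lt).
case=> [|[]//]; by move: (fg) => [_ <-]; exact: names_restr.
Qed.

Lemma names_fresh f g : child f g ->
  forall s, names f s `&` new_names g s = set0.
Proof.
move=> [lg _] s; apply/seteqP; split=> // v [/namesE [lt _] [_]].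
by rewrite lg => /ksucc_inj e; rewrite e ltxx in lt.
Qed.

Lemma names_limit f : is_limit (len f) -> forall s, names f s =
  \bigcup_(alpha in [set alpha | alpha < len f]) names (restr f alpha) s.
Proof.
move=> lf s; apply/seteqP; split=> v.
  move/namesE => [lt hx]; exists (ksucc v.1); first exact: limit_ksucc.
  apply/namesE; rewrite len_restr ?ksucc_le// fact_restr ?lt_ksucc//.
by case=> alpha _; exact: names_restr.
Qed.

Definition name_tree : var_tree Sigma gamma :=
  VarTree names_child names_fresh names_limit.

Definition raw (Z : ctx Sigma) (nm : forall s, Z s -> name s) f : formula Z :=
  And (seg_small (len f)) (fun i => claim_at nm (fact f (val i))).

Lemma raw_elim (Z : ctx Sigma) (nm : forall s, Z s -> name s) f alpha : alpha < len f ->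
  raw nm f |- claim_at nm (fact f alpha).
Proof.
by move=> lt; exact: (D_and_elim T (seg_small (len f))
  (fun i => claim_at nm (fact f (val i))) (exist _ alpha lt)).
Qed.

Lemma raw_intro (Z : ctx Sigma) (nm : forall s, Z s -> name s) f theta :
  (forall alpha, alpha < len f -> theta |- claim_at nm (fact f alpha)) -> theta |- raw nm f.
Proof. by move=> h; apply: D_and_intro => i; apply: h; exact: (valP i). Qed.

(** * Legal moves and the formula of a node *)

Definition small_code I (sI : small kappa I) : I -> kappa := sval (cid (small_embeds sI)).

Lemma small_code_inj I (sI : small kappa I) : injective (small_code sI).
Proof. exact: svalP (cid (small_embeds sI)). Qed.

(* The code [e] selects a conjunct when [L] is a conjunction and is ignored
   otherwise; [beta] is the level of the names introduced for an existential. *)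
Definition treats (L : claim) (beta e : kappa) (L' : claim) : Prop :=
  match clform L in formula X return subst X name -> Prop with
  | Rel _ _ _ | Eq _ _ _ _ => fun=> L' = trivial Sigma
  | And X J sJ phi => fun d =>
      (exists i, small_code sJ i = e /\ L' = Claim (phi i) d) \/
      (~ (exists i, small_code sJ i = e) /\ L' = trivial Sigma)
  | Or X J phi => fun d => exists i, L' = Claim (phi i) d
  | Ex X Y phi => fun d => L' = @Claim _ _ (ctx_add X Y) phi
      (copair d (fun s y => Var (beta, small_code (vars_small Y) (existT _ s y))))
  end (clsub L).

(** The code [e] refers to the names at the fixed stage [alpha], so the same task denotes the same
    instance at all later nodes of a branch; provability is tested at [f]. *)
Definition applicable f c alpha e (d : subst (sctx (ax c)) (vset_ctx (names (restr f alpha)))) :=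
  scode d = e /\
  raw (@vnm _ _ (names f)) f |-
    claim_at (@vnm _ _ (names f)) (Claim (antecedent (ax c)) (named (@vnm _ _ _) d)).

(** The idle claim [trivial] is prescribed when the task points to a claim not yet made or to an
    instance that is not applicable. *)
Definition allowed f m : Prop :=
  match bk (len f) with
  | inl (alpha, e) =>
      if alpha < len f then treats (fact f alpha) (len f) e (lc m)
      else lc m = trivial Sigma
  | inr (c, (alpha, e)) =>
      (exists d, @applicable f c alpha e d /\
         lc m = Claim (succedent (ax c)) (named (@vnm _ _ _) d)) \/
      (~ (exists d, @applicable f c alpha e d) /\ lc m = trivial Sigma)
  end.

(** The second clause confines the claim to names introduced up to and including its own move,
    whence [ksucc alpha]. *)
Definition legal_at f alpha :=
  allowed (restr f alpha) (at_ f alpha) /\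
  supported (@vnm _ _ (names (restr f (ksucc alpha)))) (fact f alpha).

Definition legal f := forall alpha, alpha < len f -> legal_at f alpha.

Lemma legal_at_restr f alpha beta : alpha < beta -> legal_at (restr f beta) alpha = legal_at f alpha.
Proof.
move=> lt; rewrite /legal_at fact_restr // at_restr // !restr_restr ?ksucc_le//.
exact: ltW.
Qed.

Lemma legal_restr f beta : legal f -> legal (restr f beta).
Proof.
move=> lf alpha; rewrite lt_min => /andP [l1 l2].
by rewrite legal_at_restr //; exact: lf.
Qed.

Lemma supported_names (A : vset (kappa := kappa) name) (Z : ctx Sigma) (nm : forall s, Z s -> name s) L :
  (forall s v, A s v -> exists z, nm s z = v) ->
  supported (@vnm _ _ A) L -> supported nm L.
Proof.
move=> sub.
have r s : forall v : vset_ctx A s, exists z : Z s, nm s z = sval v.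
  by move=> [v hv]; exact: sub.
pose rho s := projT1 (choice (@r s)).
have rhoE s (v : vset_ctx A s) : nm s (rho s v) = vnm v.
  exact: (projT2 (choice (@r s)) v).
exact: supported_rename rhoE L.
Qed.

Lemma legal_supported f alpha : legal f -> alpha < len f ->
  supported (@vnm _ _ (names f)) (fact f alpha).
Proof.
move=> lf lt; have [_] := lf _ lt; apply: supported_names => s v hv.
by exists (exist _ v (names_restr hv)).
Qed.

Lemma rename_raw f (Z : ctx Sigma) (nm : forall s, Z s -> name s)
    (nmi : forall s, injective (nm s)) (r : forall s, vset_ctx (names f) s -> Z s) :
  (forall s v, nm s (r s v) = sval v) -> legal f ->
  rename r (raw (@vnm _ _ (names f)) f) = raw nm f.
Proof.
move=> rE lf; congr And; apply: dfunext => i.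
apply: (rename_claim rE nmi); apply: legal_supported => //; exact: (valP i).
Qed.

Definition node f : formula (vset_ctx (names f)) :=
  if pselect (legal f) then raw (@vnm _ _ (names f)) f else Bot _.

Lemma node_legal f : legal f -> node f = raw (@vnm _ _ (names f)) f.
Proof. by rewrite /node; case: pselect. Qed.

Lemma node_illegal f : ~ legal f -> node f = Bot _.
Proof. by rewrite /node; case: pselect. Qed.

(** * Each node proves the disjunction of its children *)

Section Successor.
Variables (f : kseq kappa gamma) (lf : legal f) (m : gamma) (am : allowed f m).
Let g := snoc m0 f m.
Hypothesis sm : supported (@vnm _ _ (names g)) (lc m).
Variables (Z : ctx Sigma) (nm : forall s, Z s -> name s).
Hypothesis nmi : forall s, injective (@nm s).
Variable iota : forall s, vset_ctx (names f) s -> Z s.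
Hypothesis iotaE : forall s v, @nm s (@iota s v) = sval v.
Hypothesis namesZ : forall s v, names g s v -> exists z, @nm s z = v.

Lemma legal_snoc : legal g.
Proof.
move=> alpha; rewrite lt_ksuccE le_eqVlt => /predU1P [->|lt].
  by rewrite /legal_at /fact /g at_snoc_len restr_snoc // !restr_ge.
have := lf lt; rewrite /legal_at /fact /g at_snoc // !restr_snoc ?ksucc_le //.
exact: ltW.
Qed.

Definition successors : formula (vset_ctx (names f)) :=
  Or (fun g : {g | child f g} =>
    Ex (rename (split_var (vt_child_sub (V := name_tree) (svalP g))) (node (sval g)))).

(** The child [g] is the disjunct proved: over [Z] all its claims hold, and its fresh names are
    witnessed by the variables of [Z] that carry them. *)
Lemma snoc_cover theta : theta |- rename iota (node f) -> theta |- claim_at nm (lc m) ->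
  theta |- rename iota successors.
Proof.
move=> hf hm.
have thg : theta |- raw nm g.
  apply: raw_intro => alpha; rewrite lt_ksuccE le_eqVlt => /predU1P [->|lt].
    by rewrite /fact /g at_snoc_len.
  rewrite /fact /g at_snoc //; apply: D_cut hf _.
  by rewrite node_legal // (rename_raw nmi iotaE) //; exact: raw_elim.
have r s : forall v : vset_ctx (names g) s, exists z : Z s, @nm s z = sval v.
  by move=> [v hv]; exact: namesZ.
pose rho s := projT1 (choice (@r s)).
have rhoE s v : nm (@rho s v) = sval v by exact: (projT2 (choice (@r s)) v).
pose gg : {g | child f g} := exist _ g (child_snoc m0 f m).
rewrite /rename /successors /=.
apply: D_cut (D_or_intro _ _ gg).
pose e : subst (vset_ctx (new_names g)) Z :=
  fun s v => Var (rho s (exist _ (sval v) (proj1 (svalP v)))).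
apply: D_cut (ex_witness _ _ e).
rewrite /= node_legal; last exact: legal_snoc.
move: thg; rewrite -(rename_raw nmi rhoE legal_snoc) /rename !fsubst_comp.
set s1 := fun s x => _; set s2 := fun s x => _.
have -> // : s1 = s2.
apply: subst_ext => s v; rewrite /s1 /s2 /=; rewrite /split_var.
case: pselect => [hv|nv] /=; congr Var; apply: nmi; rewrite !(iotaE, rhoE) //.
Qed.

End Successor.

(** A move whose claim only uses names of [f] adds none, so [snoc_cover] applies over the context of
    [f] itself. *)
Lemma quiet_cover f m theta : legal f -> allowed f m ->
  supported (@vnm _ _ (names f)) (lc m) ->
  theta |- node f -> theta |- claim_at (@vnm _ _ (names f)) (lc m) -> theta |- successors f.
Proof.
move=> lf am sm hf hm.
have sub s v : names f s v -> names (snoc m0 f m) s v.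
  by rewrite -{1}(proj2 (child_snoc m0 f m)); exact: names_restr.
have := @snoc_cover f lf m am _ _ _ (@vnm_inj _ _ (names f)) (fun s v => v) _ _ theta.
rewrite /rename !fsubst_id; apply=> //.
  by apply: supported_names sm => s v hv; exists (exist _ v (sub _ _ hv)).
move=> s v /namesE; rewrite lt_ksuccE le_eqVlt => -[/predU1P [e|lt]].
  rewrite /fact e at_snoc_len; move: sm => [d <-] [x].
  by move=> /(@tsubst_nsub_Var _ _ _ _ _ (d s x)) [z [_ <-]]; exists z.
rewrite /fact at_snoc // => hx.
have hv : names f s v by apply/namesE.
by exists (exist _ v hv).
Qed.

Lemma trivial_cover f : legal f -> allowed f m0 -> node f |- successors f.
Proof.
move=> lf am; apply: (quiet_cover lf am) (D_id _ _) _; rewrite lc_m0.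
  by exists (fun s (x : void) => match x with end); apply: subst_ext => s [].
rewrite /claim_at; case: pselect => [e|_]; last exact: top_introP.
have -> : fsubst (clform (trivial Sigma)) (sval (cid e)) = Top _ by exact: fsubst_Top.
exact: top_introP.
Qed.

Lemma treat_cover f e L : legal f -> realized L ->
  supported (@vnm _ _ (names f)) L -> node f |- claim_at (@vnm _ _ (names f)) L ->
  (forall m, treats L (len f) e (lc m) -> allowed f m) -> node f |- successors f.
Proof.
case: L => X psi d lf rL sL.
have {sL} [d0 ed] : exists d0 : subst X (vset_ctx (names f)),
  named (@vnm _ _ (names f)) d0 = d by exact: sL.
case: _ / ed rL => rL.
rewrite (claim_atE (@vnm_inj _ _ (names f))).
case: psi d0 rL => {X d} [X R t|X s t u|X J sJ phi|X J phi|X Y phi] d0 rL hL tr.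
- by apply: trivial_cover => //; apply: tr; rewrite lc_m0.
- by apply: trivial_cover => //; apply: tr; rewrite lc_m0.
- have [[i ei]|ni] := pselect (exists i, small_code sJ i = e); last first.
    by apply: trivial_cover => //; apply: tr; right; rewrite lc_m0.
  have [m em] := realized_And i rL.
  apply: (quiet_cover lf (m := m)) (D_id _ _) _; rewrite ?em.
  + by apply: tr; rewrite em; left; exists i.
  + by exists d0.
  + rewrite (claim_atE (@vnm_inj _ _ (names f))).
    exact: (D_cut hL (D_and_elim T sJ (fun i => fsubst (phi i) d0) i)).
- apply: (or_cases hL) => i.
  have [m em] := realized_Or i rL.
  apply: (quiet_cover lf (m := m)) (conj_elim1 _ _ _) _; rewrite ?em.
  + by apply: tr; rewrite em; exists i.
  + by exists d0.
  + rewrite (claim_atE (@vnm_inj _ _ (names f))).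
    exact: conj_elim2.
apply: (ex_cases hL).
(* The bound variables receive names of level [len f]. Those of [f] have smaller levels, so the
   naming of [Z] stays injective. *)
pose Z := ctx_add (vset_ctx (names f)) Y.
pose nm s (z : Z s) : name s := match z with inl v => sval v
  | inr y => (len f, small_code (vars_small Y) (existT _ s y)) end.
pose d1 : subst (ctx_add X Y) Z := @lift_subst _ _ _ _ Y d0.
have ed1 : named nm d1 = copair (named (@vnm _ _ (names f)) d0)
    (fun s y => Var (len f, small_code (vars_small Y) (existT _ s y))).
  by apply: subst_ext => s [x|y] //; rewrite /named /d1 /= tsubst_comp.
have [m em] := realized_Ex (named nm d1) rL.
have nmi s : injective (nm s).
  move=> [v|y] [v'|y'] //=.
  - by move=> e1; rewrite (@vnm_inj _ _ (names f) s v v' e1).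
  - by move=> e1; have /namesE [] := svalP v; rewrite e1 /= ltxx.
  - by move=> e1; have /namesE [] := svalP v'; rewrite -e1 /= ltxx.
  - move=> e1; have e2 := small_code_inj (f_equal snd e1).
    by rewrite (@sigT_inj2 _ (fun s => Y s) s y y' e2).
have sub s v : names f s v -> names (snoc m0 f m) s v.
  by rewrite -{1}(proj2 (child_snoc m0 f m)); exact: names_restr.
have nmg s (z : Z s) : names (snoc m0 f m) s (nm s z).
  case: z => [v|y]; first by apply: sub; exact: svalP.
  apply/namesE; split; first by rewrite /= lt_ksucc.
  by rewrite /fact at_snoc_len em /=; exists (inr y).
apply: (@snoc_cover f lf m _ _ Z nm nmi (fun s v => inl v) _ _).
- by apply: tr; rewrite em /= ed1.
- have : supported nm (lc m) by rewrite em; exists d1.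
  pose r s z : vset_ctx (names (snoc m0 f m)) s := exist _ _ (nmg s z).
  exact: (@supported_rename _ _ _ _ nm (@vnm _ _ _) r).
- by [].
- move=> s v /namesE; rewrite lt_ksuccE le_eqVlt => -[/predU1P [e1|lt]]; last first.
    rewrite /fact at_snoc // => hx.
    have hv : names f s v by apply/namesE.
    by exists (inl (exist _ v hv)).
  rewrite /fact e1 at_snoc_len em /= ed1 => -[[x|y]] /=.
    move=> /(@tsubst_nsub_Var _ _ _ _ _ (d0 s x)) [z [_ <-]].
    by exists (inl z).
  by move=> /(@Var_inj _ _ _ _ _ _) <-; exists (inr y).
- exact: conj_elim1.
- rewrite em claim_atE //; exact: conj_elim2.
Qed.

Lemma node_cover f : node f |- successors f.
Proof.
have [lf|nl] := pselect (legal f); last first.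
  by rewrite (node_illegal nl); exact: bot_elimP.
case ebk: (bk (len f)) => [[alpha e]|[c [alpha e]]].
  have [lt|ge] := boolP (alpha < len f); last first.
    by apply: trivial_cover => //; rewrite /allowed ebk (negbTE ge).
  apply: (@treat_cover f e (fact f alpha)) => //.
  - by exists (at_ f alpha).
  - exact: legal_supported.
  - rewrite node_legal //; exact: raw_elim.
  - by move=> m h; rewrite /allowed ebk lt.
have [[d ad]|nd] := pselect (exists d, @applicable f c alpha e d); last first.
  by apply: trivial_cover => //; rewrite /allowed ebk; right.
have [m em] := realized_ax (named (@vnm _ _ _) d).
(* The instance was coded over the names at stage [alpha]; it is re-read over the larger stock of
   names at [f]. *)
pose iota s (v : vset_ctx (names (restr f alpha)) s) : vset_ctx (names f) s :=
  exist _ (sval v) (names_restr (svalP v)).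
pose d1 : subst (sctx (ax c)) (vset_ctx (names f)) :=
  fun s x => tsubst (fun s v => Var (iota s v)) (d s x).
have ed : named (@vnm _ _ _) d = named (@vnm _ _ (names f)) d1.
  by apply: subst_ext => s x; rewrite /named /d1 tsubst_comp.
apply: (@quiet_cover f m) => //; rewrite ?em.
- by rewrite /allowed ebk; left; exists d.
- by exists d1; rewrite -ed.
- exact: D_id.
- move: ad => [_]; rewrite ed !(claim_atE (@vnm_inj _ _ (names f))) => h.
  by rewrite node_legal //; apply: D_cut h _; apply: D_subst; exact: ax_derives.
Qed.

(** * Applying rule T to the tree *)

Lemma node_collect f (Z : ctx Sigma) (nm : forall s, Z s -> name s)
    (nmi : forall s, injective (nm s)) theta
    (r : forall s, vset_ctx (names f) s -> Z s)
    (rb : forall beta, beta < len f -> forall s, vset_ctx (names (restr f (ksucc beta))) s -> Z s) :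
  (forall s v, nm s (r s v) = sval v) ->
  (forall beta lt s v, nm s (rb beta lt s v) = sval v) ->
  (forall beta lt, theta |- rename (rb beta lt) (node (restr f (ksucc beta)))) ->
  theta |- rename r (node f).
Proof.
(* The claim at [beta] already belongs to the restriction to [ksucc beta], and an illegal move at
   [beta] already turns that restriction into [Bot]. So the successor restrictions suffice, both at
   limits and in the conclusion of rule T. *)
move=> rE rbE h; have [lf|nl] := pselect (legal f).
  rewrite node_legal // (rename_raw nmi rE) //; apply: raw_intro => beta lt.
  apply: D_cut (h _ lt) _; rewrite node_legal; last exact: legal_restr.
  rewrite (rename_raw nmi (rbE _ lt)); last exact: legal_restr.
  rewrite -(fact_restr f (lt_ksucc beta)); apply: raw_elim.
  by rewrite lt_min lt_ksucc lt.
have [beta [lt nb]] : exists beta, beta < len f /\ ~ legal_at f beta.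
  apply: contrapT => nb; apply: nl => beta lt; apply: contrapT => nb'.
  by apply: nb; exists beta.
apply: D_cut (h _ lt) _; rewrite node_illegal ?/rename ?fsubst_Bot; first exact: bot_elimP.
move=> lb; apply: nb; rewrite -(legal_at_restr f (lt_ksucc beta)); apply: lb.
by rewrite lt_min lt_ksucc lt.
Qed.

Lemma node_restr f g alpha (fg : restr f alpha = g)
    (r : forall s, vset_ctx (names g) s -> vset_ctx (names f) s) :
  (forall s v, sval (r s v) = sval v) -> node f |- rename r (node g).
Proof.
case: _ / fg r => r rE; have [lf|nl] := pselect (legal f); last first.
  by rewrite (node_illegal nl); exact: bot_elimP.
rewrite !node_legal //; last exact: legal_restr.
rewrite (rename_raw (@vnm_inj _ _ _) rE); last exact: legal_restr.
apply: raw_intro => beta; rewrite lt_min => /andP [l1 l2].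
by rewrite fact_restr //; exact: raw_elim.
Qed.

Definition inconsistent f : Prop := node f |- Bot _.

Lemma split_nameE (A B C : vset (kappa := kappa) name)
    (CAB : forall s, C s `<=` A s `|` B s) s (v : vset_ctx C s) :
  match split_var CAB v with inl a => sval a | inr b => sval b end = sval v.
Proof. by rewrite /split_var; case: pselect. Qed.

Lemma consistent_branch : consistent T ->
  exists b : kappa -> gamma, forall beta, ~ inconsistent (initseg b beta).
Proof.
move=> cT; apply: contrapT => nb; apply: cT.
(* All extensions of inconsistent nodes are included, which makes [B] upward closed; it meets every
   branch by the assumption [nb]. *)
pose B : set (kseq kappa gamma) := [set f | exists alpha, inconsistent (restr f alpha)].
have barB : is_bar B.
  split=> [f g fg [alpha ia]|b].
    have [le|/ltW ge] := leP alpha (len f).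
      by exists alpha; move: ia; rewrite -fg restr_restr.
    by exists (len f); move: ia; rewrite fg restr_ge.
  apply: contrapT => nB; apply: nb; exists b => beta ib; apply: nB.
  by exists beta, beta; rewrite restr_ge.
have lim f (f_lim : is_limit (len f)) :
    let conj := And (seg_small (len f)) (fun alpha : seg (len f) =>
       rename (incl_var (vt_limit_sub (V := name_tree) (f := f) f_lim (svalP alpha)))
         (node (restr f (val alpha)))) in
    derives T (node f) conj /\ derives T conj (node f).
  split; first by apply: D_and_intro => alpha; apply: node_restr.
  rewrite -[X in _ |- X](fsubst_id (node f)).
  pose sb beta (lt : beta < len f) : seg (len f) := exist _ (ksucc beta) (limit_ksucc f_lim lt).
  pose rb beta (lt : beta < len f) :=
    incl_var (vt_limit_sub (V := name_tree) (f := f) f_lim (svalP (sb beta lt))).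
  apply: (@node_collect f _ _ (@vnm_inj _ _ (names f)) _ (fun s v => v) rb) => // beta lt.
  exact: (D_and_elim T (seg_small (len f)) (fun alpha : seg (len f) =>
       rename (incl_var (vt_limit_sub (V := name_tree) (f := f) f_lim (svalP alpha)))
         (node (restr f (val alpha)))) (sb beta lt)).
have := @D_T _ _ T gamma name_tree node B barB node_cover lim.
set concl := Or _ => hT.
have {hT} : node knil |- Bot _.
  apply: (D_cut hT); apply: D_or_elim => -[f [/= [alpha ia] fmin]].
  have {ia} inf : inconsistent f.
    (* The inconsistent restriction is itself in [B], so by minimality it is [f]. *)
    rewrite -(fmin (restr f alpha)) //; last by exists alpha; rewrite restr_restr.
    have [le|/ltW ge] := leP alpha (len f); first by rewrite /kprefix len_restr.
    by rewrite (restr_ge ge) /kprefix restr_ge.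
  apply: D_ex_elim; rewrite /weaken /rename fsubst_Bot.
  set A := vset_ctx (vt_ctx name_tree knil); set Y := vset_ctx (vt_path name_tree f).
  pose nm s (z : ctx_add A Y s) : name s := match z with inl a => sval a | inr b => sval b end.
  have nmi s : injective (nm s).
    move=> [[a ha]|b]; first by case: (names_knil ha).
    case=> [[a ha]|b'] /= e; first by case: (names_knil ha).
    by rewrite (@vnm_inj _ _ _ _ b b' e).
  have sub s : vt_ctx name_tree f s `<=` vt_ctx name_tree knil s `|` vt_path name_tree f s.
    by rewrite -{1}(restr_ge (lexx (len f))); exact: vt_path_sub.
  pose rb beta (_ : beta < len f) :=
    split_var (vt_path_sub (V := name_tree) (f := f) (alpha := ksucc beta)).
  apply: (@D_cut _ _ _ _ _ (rename (split_var sub) (node f))).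
    apply: (@node_collect f _ nm nmi _ (split_var sub) rb) => [s v|beta lt s v|beta lt].
    - exact: split_nameE.
    - exact: split_nameE.
    - exact: (D_and_elim T (seg_small (len f)) (fun beta : seg (len f) =>
        rename (split_var (vt_path_sub (V := name_tree) (f := f) (alpha := ksucc (val beta))))
          (node (restr f (ksucc (val beta))))) (exist _ beta lt)).
  have := D_subst (fun s v => Var (split_var sub v)) inf.
  by rewrite fsubst_Bot.
have lk : legal knil by move=> alpha; rewrite ltNge kzero_le.
rewrite node_legal // => hk.
have {hk} : Top _ |- Bot (vset_ctx (names knil)).
  by apply: D_cut hk; apply: raw_intro => alpha; rewrite ltNge kzero_le.
(* The root has no names, so the vacuous substitution brings the contradiction down to [ctx0]. *)
move=> /(D_subst (fun s (v : vset_ctx (names knil) s) =>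
  False_rect (term (ctx0 Sigma) s) (names_knil (svalP v)))).
by rewrite fsubst_Top fsubst_Bot.
Qed.

Hypothesis scode_inj : forall c A, injective (@scode c A).
Hypothesis bk_cofinal : forall q delta, exists beta, delta < beta /\ bk beta = q.

(** * Provability along a consistent branch *)

Section Branch.
Variable b : kappa -> gamma.
Hypothesis b_consistent : forall beta, ~ inconsistent (initseg b beta).

Notation N beta := (vset_ctx (names (initseg b beta))).
Notation nm beta := (@vnm _ _ (names (initseg b beta))).
Notation node_ beta := (node (initseg b beta)).

Lemma branch_legal beta : legal (initseg b beta).
Proof.
apply: contrapT => nl; apply: (b_consistent (beta := beta)).
by rewrite /inconsistent node_illegal //; exact: D_id.
Qed.

Lemma names_le beta beta' : beta <= beta' ->
  forall s, names (initseg b beta) s `<=` names (initseg b beta') s.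
Proof. by move=> le s; rewrite -(restr_initseg m0 b le); exact: names_restr. Qed.

Lemma node_le beta beta' (le : beta <= beta') (phi : formula (N beta)) :
  node_ beta |- phi -> node_ beta' |- rename (incl_var (names_le le)) phi.
Proof.
move=> h; apply: D_cut (D_subst _ h).
by apply: (node_restr (alpha := beta)) => //; exact: (restr_initseg m0).
Qed.

Lemma named_inj (A : vset (kappa := kappa) name) X (d d' : subst X (vset_ctx A)) :
  named (@vnm _ _ A) d = named (@vnm _ _ A) d' -> d = d'.
Proof.
move=> e; apply: subst_ext => s x; apply: (tsubst_inj (@vnm_inj _ _ A)).
exact: (f_equal (fun h : subst X name => h s x) e).
Qed.

Lemma fact_initseg alpha beta : alpha < beta -> fact (initseg b beta) alpha = lc (b alpha).
Proof. by move=> lt; rewrite /fact at_initseg. Qed.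

Definition term_at beta s (t : term name s) : Prop :=
  exists t0 : term (N beta) s, tsubst (nsub (nm beta)) t0 = t.

Definition term_in s (t : term name s) : Prop := exists beta, term_at beta t.

Lemma tsubst_incl beta beta' (le : beta <= beta') s (t : term (N beta) s) :
  tsubst (nsub (nm beta')) (tsubst (fun s v => Var (incl_var (names_le le) v)) t) =
  tsubst (nsub (nm beta)) t.
Proof. by rewrite tsubst_comp. Qed.

Lemma term_at_le beta beta' s (t : term name s) : beta <= beta' ->
  term_at beta t -> term_at beta' t.
Proof.
move=> le [t0 <-]; rewrite -(tsubst_incl le).
by exists (tsubst (fun s v => Var (incl_var (names_le le) v)) t0).
Qed.

(** A context has fewer than [kappa] variables, so by regularity the stages at which their values
    appear are bounded. *)
Lemma subst_bound (X : ctx Sigma) (d : subst X name) : (forall s x, term_in (d s x)) ->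
  exists beta, forall beta', beta <= beta' -> exists d0 : subst X (N beta'), named (nm beta') d0 = d.
Proof.
move=> hd.
pose h (p : {s & X s}) := sval (cid (hd _ (projT2 p))).
have [beta hb] := small_sup h (vars_small X).
exists beta => beta' le.
have hd' s x : term_at beta' (d s x).
  apply: (@term_at_le (h (existT _ s x))); last exact: (svalP (cid (hd s x))).
  exact: le_trans (ltW (hb _)) le.
exists (fun s x => sval (cid (hd' s x))); apply: subst_ext => s x.
exact: (svalP (cid (hd' s x))).
Qed.

Definition proves beta X (phi : formula X) (d : subst X name) : Prop :=
  exists d0 : subst X (N beta), named (nm beta) d0 = d /\ node_ beta |- fsubst phi d0.

Lemma proves_le beta beta' X (phi : formula X) d : beta <= beta' ->
  proves beta phi d -> proves beta' phi d.
Proof.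
move=> le [d0 [<- h]].
exists (fun s x => tsubst (fun s v => Var (incl_var (names_le le) v)) (d0 s x)); split.
  by apply: subst_ext => s x; exact: tsubst_incl.
by have := node_le le h; rewrite /rename fsubst_comp.
Qed.

Definition eqv_at beta s (t u : term name s) : Prop :=
  exists t0 u0 : term (N beta) s, [/\ tsubst (nsub (nm beta)) t0 = t,
    tsubst (nsub (nm beta)) u0 = u & node_ beta |- Eq t0 u0].

Definition eqv s (t u : term name s) : Prop := exists beta, eqv_at beta t u.

(** Terms over the names of a stage are determined by their images ([tsubst_inj]), so the
    representatives in [eqv_at] are [t] and [u]. *)
Lemma eqv_atE beta s (t u : term (N beta) s) :
  eqv_at beta (tsubst (nsub (nm beta)) t) (tsubst (nsub (nm beta)) u) -> node_ beta |- Eq t u.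
Proof.
by move=> [t0 [u0 [/(tsubst_inj (@vnm_inj _ _ _)) <- /(tsubst_inj (@vnm_inj _ _ _)) <-]]].
Qed.

Lemma eqv_at_le beta beta' s (t u : term name s) : beta <= beta' ->
  eqv_at beta t u -> eqv_at beta' t u.
Proof.
move=> le [t0 [u0 [<- <- h]]].
exists (tsubst (fun s v => Var (incl_var (names_le le) v)) t0),
  (tsubst (fun s v => Var (incl_var (names_le le) v)) u0).
by split; [exact: tsubst_incl..|exact: (node_le le h)].
Qed.

Lemma eqv_refl s (t : term name s) : term_in t -> eqv t t.
Proof. by move=> [beta [t0 e]]; exists beta, t0, t0; split=> //; exact: eq_reflP. Qed.

Lemma eqv_sym s (t u : term name s) : eqv t u -> eqv u t.
Proof. by move=> [beta [t0 [u0 [e1 e2 h]]]]; exists beta, u0, t0; split=> //; exact: eq_symP. Qed.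

Lemma common_bound beta1 beta2 : exists beta : kappa, beta1 <= beta /\ beta2 <= beta.
Proof. by have [le|/ltW le] := leP beta1 beta2; [exists beta2 | exists beta1]. Qed.

Lemma eqv_trans s (t u v : term name s) : eqv t u -> eqv u v -> eqv t v.
Proof.
move=> [b1 h1] [b2 h2]; have [beta [le1 le2]] := common_bound b1 b2.
have [t0 [u0 [et eu h]]] := eqv_at_le le1 h1.
have [u0' [v0 [eu' ev h']]] := eqv_at_le le2 h2.
have euu : u0 = u0' by apply: (tsubst_inj (@vnm_inj _ _ _)); rewrite eu eu'.
exists beta, t0, v0; split=> //; apply: eq_transP h _; by rewrite euu.
Qed.

Lemma eqv_in s (t u : term name s) : eqv t u -> term_in t.
Proof. by move=> [beta [t0 [_ [et _ _]]]]; exists beta, t0. Qed.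

Lemma eqv_family (a : kseq kappa sorts) (t u : forall i : seg (len a), term name (kat i)) :
  (forall i, eqv (t i) (u i)) ->
  exists beta, forall beta', beta <= beta' -> forall i, eqv_at beta' (t i) (u i).
Proof.
move=> h; have [beta hb] := small_sup (fun i => sval (cid (h i))) (seg_small (len a)).
exists beta => beta' le i; apply: (eqv_at_le (le_trans (ltW (hb i)) le)).
exact: (svalP (cid (h i))).
Qed.

Lemma family_at (a : kseq kappa sorts) beta (t : forall i : seg (len a), term name (kat i)) :
  (forall i, term_at beta (t i)) ->
  exists t0 : forall i : seg (len a), term (N beta) (kat i),
    t = fun i => tsubst (nsub (nm beta)) (t0 i).
Proof.
move=> h; exists (fun i => sval (cid (h i))); apply: dfunext => i.
by rewrite (svalP (cid (h i))).
Qed.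

Lemma eqv_App (f : fun_sym Sigma) (t u : forall i : seg (len (fdom f)), term name (kat i)) :
  (forall i, eqv (t i) (u i)) -> eqv (App t) (App u).
Proof.
move=> /eqv_family [beta /(_ _ (lexx _)) h].
have [|t0 et] := @family_at _ beta t; first by move=> i; have [t0 [w [? _ _]]] := h i; exists t0.
have [|u0 eu] := @family_at _ beta u; first by move=> i; have [w [u0 [_ ? _]]] := h i; exists u0.
exists beta, (App t0), (App u0); split; rewrite ?et ?eu //.
by apply: app_congr => i; apply: eqv_atE; move: (h i); rewrite et eu.
Qed.

Definition rel_at beta (r : rel_sym Sigma) (t : forall i : seg (len (rdom r)), term name (kat i)) :=
  exists t0 : forall i, term (N beta) (kat i),
    t = (fun i => tsubst (nsub (nm beta)) (t0 i)) /\ node_ beta |- Rel t0.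

Lemma rel_at_le beta beta' (r : rel_sym Sigma) (t : forall i : seg (len (rdom r)), term name (kat i)) :
  beta <= beta' -> rel_at beta t -> rel_at beta' t.
Proof.
move=> le [t0 [-> h]].
exists (fun i => tsubst (fun s v => Var (incl_var (names_le le) v)) (t0 i)).
split; last exact: (node_le le h).
by apply: dfunext => i; rewrite tsubst_incl.
Qed.

Lemma rel_at_congr beta (r : rel_sym Sigma) (t u : forall i : seg (len (rdom r)), term name (kat i)) :
  rel_at beta t -> (forall i, eqv (t i) (u i)) -> exists beta', rel_at beta' u.
Proof.
move=> ht /eqv_family [beta1 h]; have [beta' [le le1]] := common_bound beta beta1.
have {}h := h _ le1; have [t0 [et ht0]] := rel_at_le le ht.
have [|u0 eu] := @family_at _ beta' u; first by move=> i; have [w [u0 [_ ? _]]] := h i; exists u0.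
exists beta', u0; split=> //; apply: rel_congr ht0 => i.
by apply: eqv_atE; move: (h i); rewrite et eu.
Qed.

(** * The term model of the branch *)

Definition domain s : Type :=
  {C : set (term name s) | exists t, term_in t /\ C = [set u | eqv t u]}.

Definition denotes s (x : domain s) (t : term name s) : Prop := sval x t.

Lemma denotes_ex s (x : domain s) : exists t, denotes x t.
Proof. by case: x => C [t [ht e]]; exists t; rewrite /denotes /= e; exact: eqv_refl. Qed.

Lemma denotes_eqv s (x : domain s) t u : denotes x t -> (denotes x u <-> eqv t u).
Proof.
case: x => C [v [hv e]]; rewrite /denotes /= e => h; split=> [|]; last exact: eqv_trans.
by apply: eqv_trans; exact: eqv_sym.
Qed.

Lemma denotes_in s (x : domain s) t : denotes x t -> term_in t.
Proof. by case: x => C [v [hv e]]; rewrite /denotes /= e => /eqv_sym /eqv_in. Qed.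

Lemma denotes_unique s (x y : domain s) t : denotes x t -> denotes y t -> x = y.
Proof.
move=> hx hy; have e : sval x = sval y.
  apply/seteqP; split=> u hu.
    by apply/(denotes_eqv _ hy); apply/(denotes_eqv _ hx).
  by apply/(denotes_eqv _ hx); apply/(denotes_eqv _ hy).
case: x y e {hx hy} => [C hC] [C' hC'] /= e; case: _ / e hC' => hC'.
by congr exist; exact: Prop_irrelevance.
Qed.

Lemma denoted_ex s (t : term name s) : term_in t -> exists x : domain s, denotes x t.
Proof.
move=> ht; exists (exist _ [set u | eqv t u] (ex_intro _ t (conj ht erefl))).
exact: eqv_refl.
Qed.

(** Representatives of the arguments are chosen; [eqv_App] makes the class of the application
    independent of the choice. *)
Lemma fun_ex (f : fun_sym Sigma) (c : forall i : seg (len (fdom f)), domain (kat i)) :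
  exists x : domain (fcod f), forall t, (forall i, denotes (c i) (t i)) -> denotes x (App t).
Proof.
have [t ht] : exists t : forall i : seg (len (fdom f)), term name (kat i), forall i, denotes (c i) (t i).
  exists (fun i => sval (cid (denotes_ex (c i)))) => i.
  exact: (svalP (cid (denotes_ex (c i)))).
have eq u : (forall i, denotes (c i) (u i)) -> eqv (App t) (App u).
  by move=> hu; apply: eqv_App => i; apply/(denotes_eqv _ (ht i)); exact: hu.
have [x hx] := denoted_ex (eqv_in (eq _ ht)).
by exists x => u /eq; move/(denotes_eqv _ hx).
Qed.

Definition dfun (f : fun_sym Sigma) (c : forall i : seg (len (fdom f)), domain (kat i)) :
    domain (fcod f) := sval (cid (fun_ex c)).

(** Asking for some representatives is enough, as [rel_at_congr] carries provability over to all
    others. *)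
Definition drel (r : rel_sym Sigma) (c : forall i : seg (len (rdom r)), domain (kat i)) : Prop :=
  exists t, (forall i, denotes (c i) (t i)) /\ exists beta, rel_at beta t.

Definition denv X (e : forall s, X s -> domain s) (d : subst X name) : Prop :=
  forall s x, denotes (e s x) (d s x).

Lemma denv_ex X (e : forall s, X s -> domain s) : exists d, denv e d.
Proof.
exists (fun s x => sval (cid (denotes_ex (e s x)))) => s x.
exact: (svalP (cid (denotes_ex (e s x)))).
Qed.

Lemma denv_bound (X : ctx Sigma) (e : forall s, X s -> domain s) d : denv e d ->
  exists beta, forall beta', beta <= beta' -> exists d0 : subst X (N beta'), named (nm beta') d0 = d.
Proof. by move=> ed; apply: subst_bound => s x; exact: denotes_in (ed s x). Qed.

Lemma teval_denotes X (e : forall s, X s -> domain s) d (ed : denv e d) s (t : term X s) :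
  denotes (teval dfun e t) (tsubst d t).
Proof.
elim: t => {s} [s x|f ts IH] /=; first exact: ed.
exact: (svalP (cid (fun_ex (fun i => teval dfun e (ts i))))).
Qed.

(** Truth is provable at some stage, which makes antecedents of axioms applicable. For a
    conjunction, fewer than [kappa] stages have a common bound; for an existential, terms denoting
    the witnesses instantiate it. *)
Lemma sat_proves X (phi : formula X) : forall (e : forall s, X s -> domain s) d,
  denv e d -> sat dfun drel phi e -> exists beta, proves beta phi d.
Proof.
elim: phi => {X} [X r t|X s t u|X J sJ phi IH|X J phi IH|X Y phi IH] e d ed /=.
- move=> [ts [hts [b1 h1]]].
  have [b2 h2] : exists b2, rel_at b2 (fun i => tsubst d (t i)).
    apply: (rel_at_congr h1) => i; apply/(denotes_eqv _ (hts i)).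
    exact: teval_denotes.
  have [b3 h3] := denv_bound ed; have [beta [le2 le3]] := common_bound b2 b3.
  have [d0 ed0] := h3 _ le3; have [t0 [et ht]] := rel_at_le le2 h2.
  exists beta, d0; split=> //=.
  have -> // : (fun i => tsubst d0 (t i)) = t0.
  apply: dfunext => i; apply: (tsubst_inj (@vnm_inj _ _ _)).
  have := f_equal (fun h => h i) et => /= <-.
  by rewrite tsubst_comp -ed0.
- move=> etu.
  have [b2 h2] : eqv (tsubst d t) (tsubst d u).
    apply/(denotes_eqv _ (teval_denotes ed t)); rewrite etu; exact: teval_denotes.
  have [b3 h3] := denv_bound ed; have [beta [le2 le3]] := common_bound b2 b3.
  have [d0 ed0] := h3 _ le3; exists beta, d0; split=> //=.
  by apply: eqv_atE; have := eqv_at_le le2 h2; rewrite !tsubst_comp -ed0.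
- move=> h; have hi i := IH i e d ed (h i).
  have [b1 h1] := small_sup (fun i => sval (cid (hi i))) sJ.
  have [b3 h3] := denv_bound ed; have [beta [le1 le3]] := common_bound b1 b3.
  have [d0 ed0] := h3 _ le3; exists beta, d0; split=> //=.
  apply: D_and_intro => i.
  have := proves_le (le_trans (ltW (h1 i)) le1) (svalP (cid (hi i))).
  by move=> [d1 [+ h']]; rewrite -ed0 => /(@named_inj _ _ _ _) e'; rewrite -e'.
- move=> [i /(IH i e d ed) [beta [d0 [ed0 h0]]]]; exists beta, d0; split=> //=.
  exact: D_cut h0 (D_or_intro T (fun i => fsubst (phi i) d0) i).
- move=> [e' he]; have [d' ed'] := denv_ex e'.
  have [|beta [d1 [ed1 h1]]] := IH _ (copair d d') _ he; first by move=> s [x|y] /=.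
  exists beta, (fun s x => d1 s (inl x)); split.
    by apply: subst_ext => s x; exact: (f_equal (fun h : subst _ name => h s (inl x)) ed1).
  apply: D_cut h1 _; apply: D_cut (ex_witness T _ (fun s y => d1 s (inr y))).
  rewrite fsubst_comp; set d2 := fun s x => _.
  have -> : d2 = d1 by apply: subst_ext => s [x|y] //; rewrite /d2 /= tsubst_comp tsubst_id.
  exact: D_id.
Qed.

Lemma branch_step beta :
  allowed (initseg b beta) (b beta) /\
  supported (nm (ksucc beta)) (lc (b beta)).
Proof.
have := branch_legal (lt_ksucc beta); rewrite /legal_at fact_initseg ?lt_ksucc //.
rewrite at_initseg ?lt_ksucc // !(restr_initseg m0) ?(ltW (lt_ksucc _)) //.
Qed.

Lemma fact_proves X (phi : formula X) d beta : lc (b beta) = Claim phi d ->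
  proves (ksucc beta) phi d.
Proof.
move=> e; have [_] := branch_step beta; rewrite e => -[d0 /= ed0].
exists d0; split=> //.
have := @raw_elim _ (nm (ksucc beta)) (initseg b (ksucc beta)) beta (lt_ksucc beta).
rewrite fact_initseg ?lt_ksucc // e -ed0 (claim_atE (@vnm_inj _ _ _)).
by rewrite node_legal //; exact: branch_legal.
Qed.

(** The task recurs after stage [alpha], when the claim made there is on record. *)
Lemma treated alpha e : exists beta, treats (lc (b alpha)) beta e (lc (b beta)).
Proof.
have [beta [lt ebk]] := bk_cofinal (inl (alpha, e)) alpha.
exists beta; have [] := branch_step beta; rewrite /allowed ebk lt.
by rewrite fact_initseg.
Qed.

(** Atomic claims are provable one stage later, hence true in the term model; a compound claim is
    eventually treated and reduces to a claim on a subformula. *)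
Lemma fact_sat X (phi : formula X) : forall d beta, lc (b beta) = Claim phi d ->
  forall e, denv e d -> sat dfun drel phi e.
Proof.
elim: phi => {X} [X r t|X s t u|X J sJ phi IH|X J phi IH|X Y phi IH] d beta eb e ed /=.
- have [d0 [ed0 h]] := fact_proves eb.
  exists (fun i => tsubst d (t i)); split=> [i|]; first exact: teval_denotes.
  exists (ksucc beta), (fun i => tsubst d0 (t i)); split=> //.
  by apply: dfunext => i; rewrite tsubst_comp -ed0.
- have [d0 [ed0 h]] := fact_proves eb.
  apply: (denotes_unique (teval_denotes ed t)).
  apply/(denotes_eqv _ (teval_denotes ed u)); apply: eqv_sym.
  exists (ksucc beta), (tsubst d0 t), (tsubst d0 u).
  by split=> //; rewrite tsubst_comp -ed0.
- move=> i; have [beta' ] := treated beta (small_code sJ i); rewrite eb.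
  case=> [[i' [ei eb']]|[ni _]].
    by rewrite (small_code_inj ei) in eb'; exact: IH eb' _ ed.
  by case: ni; exists i.
(* Only conjunctions read the code of the task, so [beta] stands in as an arbitrary one, here and
   for existentials. *)
- have [beta' ] := treated beta beta; rewrite eb => -[i eb'].
  by exists i; exact: IH eb' _ ed.
have [beta' ] := treated beta beta; rewrite eb /treats /= => eb'.
(* The new names lie in the stock of stage [ksucc beta'] because the new claim is supported there;
   the elements they denote are the witnesses. *)
have [d1 [ed1 _]] := fact_proves eb'.
have hy s (y : Y s) : exists x : domain s,
    denotes x (Var (beta', small_code (vars_small Y) (existT _ s y))).
  apply: denoted_ex; exists (ksucc beta'), (d1 s (inr y)).
  exact: (f_equal (fun h : subst _ name => h s (inr y)) ed1).
exists (fun s y => sval (cid (hy s y))); apply: IH eb' _ _ => s [x|y] /=; first exact: ed.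
exact: (svalP (cid (hy s y))).
Qed.

Lemma axiom_sat c (e : forall s, sctx (ax c) s -> domain s) :
  sat dfun drel (antecedent (ax c)) e -> sat dfun drel (succedent (ax c)) e.
Proof.
have [d ed] := denv_ex e => /(sat_proves ed) [alpha pa].
have [d0 [ed0 _]] := pa.
have [beta [lt ebk]] := bk_cofinal (inr (c, (alpha, scode d0))) alpha.
(* Stated for any [g] equal to the initial segment, since the type of the substitution depends on
   [g]. Injectivity of [scode] makes the coded instance unique. *)
have code g : g = initseg b alpha ->
    (exists d1 : subst (sctx (ax c)) (vset_ctx (names g)),
       scode d1 = scode d0 /\ named (@vnm _ _ (names g)) d1 = d) /\
    (forall d1 : subst (sctx (ax c)) (vset_ctx (names g)),
       scode d1 = scode d0 -> named (@vnm _ _ (names g)) d1 = d).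
  by move=> ->; split=> [|d1 /scode_inj ->//]; exists d0.
have [[d1 [ed1 nd1]] code_uniq] := code _ (restr_initseg m0 b (ltW lt)).
have [] := branch_step beta; rewrite /allowed ebk.
case=> [[d2 [[ed2 _] eb]] _|[na _]].
  by rewrite (code_uniq _ ed2) in eb; exact: fact_sat eb _ ed.
(* The antecedent, provable at [alpha], remains provable at [beta], so the idle alternative is
   excluded. *)
case: na; exists d1; split=> //; rewrite nd1.
have [d3 [<- h3]] := proves_le (ltW lt) pa.
by rewrite (claim_atE (@vnm_inj _ _ _)) -node_legal //; exact: branch_legal.
Qed.

End Branch.

Lemma tree_model : consistent T -> exists M : beth_structure Sigma,
  (forall c, forces_sequent M (ax c)) /\
  (forall k (e : env k (ctx0 Sigma)), ~ forces (M := M) (Bot (ctx0 Sigma)) e).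
Proof.
move=> /consistent_branch [b b_consistent].
exists (constant_beth (@dfun b) (@drel b)); split=> [c k e|k e].
  move=> /forces_constant h; apply/forces_constant; exact: (axiom_sat b_consistent h).
by move=> /forces_constant [].
Qed.

End Tree.

(** * Coding terms and subformulas *)

Section Codes.
Variables (kappa : regularCardinal) (Sigma : signature kappa).
Notation sorts := (sorts Sigma).
Hypothesis kappa_exp : [set: kseq kappa kappa] #= [set: kappa].
Hypothesis fsym_embeds : embeds kappa (fun_sym Sigma).

(** A term is coded by its variable, or by its symbol with the sequence of the codes of its
    arguments, of length below [kappa]. *)
Lemma term_embeds (Z : sorts -> Type) : embeds kappa {s & Z s} -> embeds kappa {s & term Z s}.
Proof.
move=> eZ.
have [c ci] : embeds kappa ({s & Z s} + fun_sym Sigma * kseq kappa kappa).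
  apply: sum_embeds => //; apply: prod_embeds => //; exact: kseq_embeds.
pose fix code s (t : term Z s) : kappa := match t with
  | Var s z => c (inl (existT _ s z))
  | App f ts => c (inr (f, existT (fun beta => seg beta -> kappa) (len (fdom f)) (fun i => code _ (ts i))))
  end.
have code_inj s (t : term Z s) : forall s' (t' : term Z s'), code s t = code s' t' ->
    existT (term Z) s t = existT (term Z) s' t'.
  elim: t => {s} [s z|f ts IH] s' [{}s' z'|f' ts'] /= /ci // e.
    exact: (f_equal (fun q => match q with
      | inl p => existT (term Z) (projT1 p) (Var (projT2 p))
      | inr _ => existT (term Z) s (Var z) end) e).
  have ef : f = f' := f_equal (fun q => match q with inl _ => f | inr p => p.1 end) e.
  have {e} := f_equal (fun q => match q with inl _ => knil | inr p => p.2 end) e.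
  case: _ / ef ts' => ts' /= /(@sigT_inj2 _ (fun beta => seg beta -> kappa)) e.
  congr existT; congr App; apply: dfunext => i; apply: sigT_inj2.
  by apply: IH; exact: (f_equal (fun h => h i) e).
exists (fun p => code _ (projT2 p)) => -[s t] [s' t'] /=; exact: code_inj.
Qed.

Lemma subst_embeds (X Z : ctx Sigma) : embeds kappa (subst X Z).
Proof.
have : embeds kappa ({s & X s} -> {s & term Z s}).
  apply: fun_embeds => //; first exact: vars_small.
  by apply: term_embeds; apply: small_embeds; exact: vars_small.
pose h (d : subst X Z) (p : {s & X s}) : {s & term Z s} :=
  existT _ (projT1 p) (d _ (projT2 p)).
apply: (@embeds_inj _ _ _ h) => d d' e.
apply: subst_ext => s x; apply: sigT_inj2.
exact: (f_equal (fun k => k (existT _ s x)) e).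
Qed.

End Codes.

Section Positions.
Variables (kappa : regularCardinal) (Sigma : signature kappa).

(* The positions of the subformulas of a formula.  Unlike the formulas
   themselves, they live in the universe of the index types of disjunctions,
   as the branching of the tree in rule T must. *)
Fixpoint pos (X : ctx Sigma) (phi : formula X) : Type :=
  match phi with
  | Rel _ _ _ | Eq _ _ _ _ => unit
  | And _ J _ phi => option {i : J & pos (phi i)}
  | Or _ J phi => option {i : J & pos (phi i)}
  | Ex _ _ phi => option (pos phi)
  end.

Fixpoint subformula (X : ctx Sigma) (phi : formula X) : pos phi -> {X : ctx Sigma & formula X} :=
  match phi return pos phi -> {X : ctx Sigma & formula X} with
  | Rel X r t => fun=> existT _ X (Rel t)
  | Eq X s t u => fun=> existT _ X (Eq t u)
  | And X J sJ phi => fun p =>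
      if p is Some (existT i q) then subformula q else existT _ X (And sJ phi)
  | Or X J phi => fun p =>
      if p is Some (existT i q) then subformula q else existT _ X (Or phi)
  | Ex X Y phi => fun p => if p is Some q then subformula q else existT _ X (Ex phi)
  end.

Definition step_closed (S : {X : ctx Sigma & formula X} -> Prop) (F : {X : ctx Sigma & formula X}) : Prop :=
  match projT2 F in formula X return Prop with
  | Rel _ _ _ | Eq _ _ _ _ => True
  | And X J _ phi => forall i, S (existT _ X (phi i))
  | Or X J phi => forall i, S (existT _ X (phi i))
  | Ex X Y phi => S (existT _ (ctx_add X Y) phi)
  end.

Lemma step_closed_mono (S S' : {X : ctx Sigma & formula X} -> Prop) F :
  (forall G, S G -> S' G) -> step_closed S F -> step_closed S' F.
Proof. by move=> SS; case: F => X []; rewrite /step_closed /=; auto. Qed.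

Lemma subformula_self (X : ctx Sigma) (phi : formula X) : exists p, @subformula X phi p = existT _ X phi.
Proof. by case: phi => *; try (by exists tt); exists None. Qed.

Lemma subformula_closed (X : ctx Sigma) (phi : formula X) (p : pos phi) :
  step_closed (fun G => exists q, @subformula X phi q = G) (subformula p).
Proof.
elim: phi p => {X} [X r t|X s t u|X J sJ phi IH|X J phi IH|X Y phi IH] //= [].
- move=> [i q]; apply: step_closed_mono (IH i q) => G [q' eq'].
  by exists (Some (existT _ i q')).
- move=> i; have [q eq] := subformula_self (phi i).
  by exists (Some (existT _ i q)).
- move=> [i q]; apply: step_closed_mono (IH i q) => G [q' eq'].
  by exists (Some (existT _ i q')).
- move=> i; have [q eq] := subformula_self (phi i).
  by exists (Some (existT _ i q)).
- by move=> q; apply: step_closed_mono (IH q) => G [q' eq']; exists (Some q').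
- by have [q eq] := subformula_self phi; exists (Some q).
Qed.

End Positions.

(* The bound on the function symbols is implicit in the informal statement,
   which fails without it: with kappa = omega and omega_1 constants, the
   axioms |-_x \/_n F_n(x) and \/_(i <> j) c_i = c_j |- bot together with
   F_n(x) /\ F_n(y) |- x = y are consistent but have no Beth model. *)
Theorem theorem2p12 (kappa : regularCardinal)
    (kappa_exp : [set: kseq kappa kappa] #= [set: kappa])
    (Sigma : signature kappa)
    (Sigma_fsym : [set: fun_sym Sigma] #<= [set: kappa])
    (T : theory Sigma)
    (T_card : theory_card_le T)
    (T_consistent : consistent T) :
  exists M : beth_structure Sigma, beth_model M T.
Proof.
have [code code_inj] := T_card.
pose ax (c : kappa) : sequent Sigma :=
  match pselect (exists sigma, T sigma /\ code sigma = c) with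
  | left e => sval (cid e)
  | right _ => Sequent (Top (ctx0 Sigma)) (Top (ctx0 Sigma)) end.
have ax_derives c : derives T (antecedent (ax c)) (succedent (ax c)).
  rewrite /ax; case: pselect => [e|_]; last exact: D_id.
  by case: (cid e) => sigma [/= h _]; exact: D_axiom.
have ax_code sigma : T sigma -> ax (code sigma) = sigma.
  move=> h; rewrite /ax; case: pselect => [e|[]]; last by exists sigma.
  by case: (cid e) => tau [ht e'] /=; exact: code_inj.
(* The label of a claim locates it as a subformula of the succedent of an axiom, with a
   substitution; [None] is the idle move. *)
pose gamma := option {c : kappa & {p : pos (succedent (ax c)) &
  subst (projT1 (subformula p)) (@name kappa Sigma)}}.
pose lc (m : gamma) : claim Sigma := match m with
  | Some (existT c (existT p d)) => Claim (projT2 (subformula p)) d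
  | None => trivial Sigma end.
(* All substitutions are required, because treating an existential claim extends the substitution by
   new names. *)
pose S (F : {X & @formula kappa Sigma X}) := forall d, realized lc (Claim (projT2 F) d).
have S_sub c p : S (@subformula _ _ _ (succedent (ax c)) p).
  by move=> d; exists (Some (existT _ c (existT _ p d))).
have S_closed L : realized lc L -> step_closed S (existT _ (clctx L) (clform L)).
  case=> [[[c [p d]]|] <-]; last by case.
  apply: (@step_closed_mono _ _ _ _ (existT _ _ (projT2 (subformula p)))
    _ _); last first.
    by rewrite -sigT_eta; exact: subformula_closed.
  by move=> _ [q <-]; exact: S_sub.
have embQ : embeds kappa ((kappa * kappa) + (kappa * (kappa * kappa))).
  by do ![apply: sum_embeds => //|apply: prod_embeds => //]; exists id.
have k0 := kzero kappa.
have [bk bk_cofinal] := bookkeeping kappa_exp (inl (k0, k0)) embQ.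
pose scode c (A : vset (@name kappa Sigma)) := sval (cid
  (subst_embeds kappa_exp (card_le_embeds Sigma_fsym) (sctx (ax c)) (vset_ctx A))).
have scode_inj c A : injective (@scode c A) by exact: (svalP (cid (subst_embeds _ _ _ _))).
have r_ax c d : realized lc (@Claim _ _ (sctx (ax c)) (succedent (ax c)) d).
  have [p ep] := subformula_self (succedent (ax c)).
  by have := S_sub c p; rewrite ep; apply.
have r_And X I (sI : small kappa I) (phi : I -> formula X) d i :
    realized lc (Claim (And sI phi) d) -> realized lc (Claim (phi i) d).
  by move=> /S_closed h; exact: (h i).
have r_Or X I (phi : I -> formula X) d i :
    realized lc (Claim (Or phi) d) -> realized lc (Claim (phi i) d).
  by move=> /S_closed h; exact: (h i).
have r_Ex X Y (phi : formula (ctx_add X Y)) d d' :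
    realized lc (Claim (Ex phi) d) -> realized lc (@Claim _ _ (ctx_add X Y) phi d').
  by move=> /S_closed h; exact: (h d').
have [M [Max Mbot]] := @tree_model _ _ T gamma None lc ax scode bk
  erefl r_ax r_And r_Or r_Ex ax_derives scode_inj bk_cofinal T_consistent.
by exists M; split=> // sigma /ax_code <-.
Qed.
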